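(* Let $\Omega\subseteq\mathbf{R}^n$, $n\ge1$, be an open set. A real-valued distribution $\sigma\in D'(\Omega)$ satisfies $$\langle\sigma,h^2\rangle\le\int_\Omega|\nabla h|^2\,dx\quad\text{for all }h\in C_0^\infty(\Omega)$$ if and only if there exists $\vec\Gamma\in L^2_{\rm loc}(\Omega)^n$ such that $$\sigma\le{\rm div}(\vec\Gamma)-|\vec\Gamma|^2\quad\text{in }D'(\Omega).$$
   Context: An inequality $\mu\le\nu$ in $D'(\Omega)$ means $\langle\mu,\varphi\rangle\le\langle\nu,\varphi\rangle$ for all $\varphi\in C_0^\infty(\Omega)$ with $\varphi\ge0$. *)

(* Defs.v *)
From HB Require Import structures.
From mathcomp Require Import all_boot all_order all_algebra.
From mathcomp Require Import all_classical all_reals all_analysis.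

Set Implicit Arguments.
Unset Strict Implicit.
Unset Printing Implicit Defensive.

Import Order.TTheory GRing.Theory Num.Theory.
Import numFieldNormedType.Exports.

Local Open Scope classical_set_scope.
Local Open Scope ring_scope.

(* R^n is 'rV[R]_n with the topology of the library.  The library norm on
   'rV[R]_n is the sup norm, so Euclidean lengths are written with [dot]. *)

Definition measure_rV_display : measure_display -> measure_display.
Proof. exact. Qed.

(* The product sigma-algebra, generated by the coordinates: the counterpart on
   row vectors of the library's sigma-algebra on n.-tuple T.  For T := R it is
   the Borel sigma-algebra of R^n. *)
Section measurable_rV.
Context {d : measure_display} {T : measurableType d}.
Variable n : nat.

Let coors : 'I_n -> 'rV[T]_n -> T := fun i x => x ord0 i.

Let rV_set0 : g_sigma_preimage coors set0.
Proof. exact: sigma_algebra0. Qed.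

Let rV_setC A : g_sigma_preimage coors A -> g_sigma_preimage coors (~` A).
Proof. exact: sigma_algebraC. Qed.

Let rV_bigcup (F : (set 'rV[T]_n)^nat) :
  (forall i, g_sigma_preimage coors (F i)) ->
  g_sigma_preimage coors (\bigcup_i (F i)).
Proof. exact: sigma_algebra_bigcup. Qed.

HB.instance Definition _ := @isMeasurable.Build (measure_rV_display d)
  'rV[T]_n (g_sigma_preimage coors) rV_set0 rV_setC rV_bigcup.

End measurable_rV.

Lemma measurable_coord d (T : measurableType d) n (i : 'I_n) :
  measurable_fun [set: 'rV[T]_n] (fun x => x ord0 i).
Proof.
move=> _ Y mY; rewrite setTI; apply: sub_sigma_algebra => /=.
rewrite -bigcup_seq/=; exists i => /=; first by rewrite mem_index_enum.
by exists Y => //; rewrite setTI.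
Qed.

Lemma measurable_fun_coordP d1 d2 (T1 : measurableType d1)
    (T2 : measurableType d2) n (f : T1 -> 'rV[T2]_n) :
  measurable_fun [set: T1] f <->
  forall i, measurable_fun [set: T1] (fun x => f x ord0 i).
Proof.
split=> [mf i|mf].
  exact: (measurableT_comp (@measurable_coord _ _ _ i) mf).
apply: (@iffRL _ (g_sigma_preimage
    (fun i => (fun v : 'rV[T2]_n => v ord0 i) \o f) `<=` measurable)); last first.
  apply: smallest_sub; first exact: sigma_algebra_measurable.
  rewrite -bigcup_seq; apply: bigcup_sub => i _ A [B mB <-]; exact: mf.
rewrite g_sigma_preimage_comp; split=> [h A [/= C preC <-]|prefS]; first exact: h.
by move=> _ A mA; apply: prefS; exists A.
Qed.

Section lebesgue_rV.
Context {R : realType}.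
Local Open Scope ereal_scope.

Definition cons_rV n (p : measurableTypeR R * 'rV[R]_n) : 'rV[R]_n.+1 :=
  row_mx (const_mx p.1 : 'rV[R]_1) p.2.

Lemma measurable_cons_rV n : measurable_fun setT (@cons_rV n).
Proof.
apply/measurable_fun_coordP => i.
have [j ->|j ->] := split_ordP (i : 'I_(1 + n)).
- rewrite (_ : (fun _ => _) = fst); first exact: measurable_fst.
  by apply/funext => p; rewrite [LHS](@row_mxEl _ 1 1 n) mxE.
- rewrite (_ : (fun _ => _) = (fun v : 'rV[R]_n => v ord0 j) \o snd).
    exact: (measurableT_comp (@measurable_coord _ _ _ j) measurable_snd).
  by apply/funext => p; exact: (@row_mxEr _ 1 1 n).
Qed.

Section lebesgue_cons.
Variables (n : nat) (m : {sigma_finite_measure set 'rV[R]_n -> \bar R}).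

Definition lebesgue_cons : set 'rV[R]_n.+1 -> \bar R :=
  pushforward (lebesgue_measure \x m) (@cons_rV n).

Let mcons : measurable_fun setT (@cons_rV n) := @measurable_cons_rV n.

Let lebesgue_cons0 : lebesgue_cons set0 = 0.
Proof. exact: measure0. Qed.

Let lebesgue_cons_ge0 A : 0 <= lebesgue_cons A.
Proof. exact: measure_ge0. Qed.

Let lebesgue_cons_sigma_additive : semi_sigma_additive lebesgue_cons.
Proof. exact: measure_semi_sigma_additive. Qed.

HB.instance Definition _ := isMeasure.Build _ _ _ lebesgue_cons
  lebesgue_cons0 lebesgue_cons_ge0 lebesgue_cons_sigma_additive.

Let sigma_finite_lebesgue_cons : sigma_finite setT lebesgue_cons.
Proof.
have /sigma_finiteP[F [TF ndF Foo]] := sigma_finiteT (@lebesgue_measure R).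
have /sigma_finiteP[G [TG ndG Goo]] := sigma_finiteT m.
pose uncons (x : 'rV[R]_n.+1) : measurableTypeR R * 'rV[R]_n :=
  (x ord0 ord0, rsubmx (x : 'rV[R]_(1 + n))).
have unconsK : uncons \o @cons_rV n = id.
  apply/funext => -[a v]; rewrite /uncons /=; congr pair.
    have e : ord0 = lshift n (ord0 : 'I_1) :> 'I_(1 + n) by exact/val_inj.
    transitivity (cons_rV (a, v) ord0 (@lshift 1 n ord0)).
      exact: (congr1 (cons_rV (a, v) ord0) e).
    by rewrite [LHS](@row_mxEl _ 1 1 n) mxE.
  exact: (@row_mxKr _ 1 1 n).
have muncons : measurable_fun setT uncons.
  apply/measurable_fun_pairP; split; first exact: measurable_coord.
  apply/measurable_fun_coordP => i.
  rewrite (_ : (fun _ => _) = (fun x : 'rV[R]_n.+1 => x ord0 (rshift 1 i))).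
    exact: measurable_coord.
  by apply/funext => x /=; rewrite mxE.
exists (fun k => uncons @^-1` (F k `*` G k)).
  rewrite -preimage_bigcup (_ : \bigcup_k (F k `*` G k) = setT) ?preimage_setT//.
  rewrite -subTset => -[a v] _.
  have [i _ Fi] : (\bigcup_k F k) a by rewrite -TF.
  have [j _ Gj] : (\bigcup_k G k) v by rewrite -TG.
  exists (maxn i j) => //; split => /=.
    by move: a Fi; exact/subsetPset/ndF/leq_maxl.
  by move: v Gj; exact/subsetPset/ndG/leq_maxr.
move=> k; have [mF Fk] := Foo k; have [mG Gk] := Goo k; split.
  by rewrite -[X in measurable X]setTI; apply: muncons => //; exact: measurableX.
rewrite /lebesgue_cons /pushforward -comp_preimage unconsK preimage_id.
by rewrite product_measure1E// lte_mul_pinfty// ge0_fin_numE.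
Qed.

HB.instance Definition _ := Measure_isSigmaFinite.Build _ _ _
  lebesgue_cons sigma_finite_lebesgue_cons.

End lebesgue_cons.

(* Lebesgue measure on R^n: the n-fold product of [lebesgue_measure]. *)
Fixpoint lebesgue_rV n : {sigma_finite_measure set 'rV[R]_n -> \bar R} :=
  if n is n'.+1 then lebesgue_cons (lebesgue_rV n') else \d_(0%R : 'rV[R]_0).

End lebesgue_rV.
Arguments lebesgue_rV R n : clear implicits.

Section distributions.
Context {R : realType} {n : nat}.
Implicit Types (Omega K : set 'rV[R]_n) (f g phi : 'rV[R]_n -> R).
Implicit Types (S T : ('rV[R]_n -> R) -> R) (Gamma : 'rV[R]_n -> 'rV[R]_n).

Local Notation mu := (lebesgue_rV R n).

Definition dot (u v : 'rV[R]_n) : R := \sum_(i < n) u ord0 i * v ord0 i.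

Definition partial (i : 'I_n) f : 'rV[R]_n -> R := 'D_(delta_mx ord0 i) f.

Definition partials (s : seq 'I_n) f : 'rV[R]_n -> R := foldr partial f s.

Definition grad f (x : 'rV[R]_n) : 'rV[R]_n := \row_i partial i f x.

(* C^oo(R^n): all iterated partial derivatives exist and are continuous. *)
Definition smooth f := forall s : seq 'I_n,
  continuous (partials s f) /\
  forall i x, derivable (partials s f) x (delta_mx ord0 i).

Definition supp f : set 'rV[R]_n := closure [set x | f x != 0].

(* C_0^oo(Omega), each function being identified with its extension by 0 to
   R^n. *)
Definition test_function Omega f :=
  [/\ smooth f, compact (supp f) & supp f `<=` Omega].

(* The sum over k <= N of sup |D^a f| over the iterated derivatives of order k;
   a derivative is indexed by the list of its directions rather than by a
   multi-index, which changes the sum at most by a factor depending on n, N. *)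
Definition seminorm (N : nat) f : R :=
  \sum_(k < N.+1) \sum_(s : k.-tuple 'I_n)
    sup (range (fun x => `|partials s f x|)).

(* D'(Omega): real linear forms on C_0^oo(Omega), continuous in the usual sense
   of seminorm estimates on each compact subset of Omega.  Values outside
   C_0^oo(Omega) are irrelevant. *)
Record schwartz_distr Omega := SchwartzDistr {
  schwartz_fun :> ('rV[R]_n -> R) -> R ;
  schwartz_linear : forall (a : R) f g,
    test_function Omega f -> test_function Omega g ->
    schwartz_fun (fun x => a * f x + g x) =
      a * schwartz_fun f + schwartz_fun g ;
  schwartz_continuous : forall K, compact K -> K `<=` Omega ->
    exists (C : R) (N : nat), forall f,
      test_function Omega f -> supp f `<=` K ->
      `|schwartz_fun f| <= C * seminorm N f }.

Definition distr_le Omega S T := forall phi, test_function Omega phi ->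
  (forall x, 0 <= phi x) -> S phi <= T phi.

Definition L2loc Omega f := measurable_fun Omega f /\
  forall K, compact K -> K `<=` Omega ->
    (\int[mu]_(x in K) (`|f x| ^+ 2)%:E < +oo)%E.

Definition L2loc_vec Omega Gamma :=
  forall i : 'I_n, L2loc Omega (fun x => Gamma x ord0 i).

Definition distr_of_fun Omega f : ('rV[R]_n -> R) -> R :=
  fun phi => \int[mu]_(x in Omega) (f x * phi x).

Definition distr_partial (i : 'I_n) T : ('rV[R]_n -> R) -> R :=
  fun phi => - T (partial i phi).

Definition distr_div Omega Gamma : ('rV[R]_n -> R) -> R :=
  fun phi => \sum_(i < n)
    distr_partial i (distr_of_fun Omega (fun x => Gamma x ord0 i)) phi.

End distributions.

(* Main.v *)
(* With F(Gamma, phi) = sigma(phi) + int (Gamma . grad phi + |Gamma|^2 phi), the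
   inequality sigma <= div Gamma - |Gamma|^2 says that F(Gamma, phi) <= 0 for all
   test functions phi >= 0.  The converse implication follows from
   |grad h + h Gamma|^2 >= 0.  For the direct one, F is convex in Gamma and linear
   in phi, and for fixed phi its infimum over Gamma is sigma(h^2) - int |grad h|^2
   with h = sqrt phi, approached by Gamma = - grad phi / (2 (phi + d)) as d -> 0.
   A minimax argument yields, for finitely many phi's, a continuous Gamma with
   F(Gamma, phi) <= e.  These constraint sets are convex and bounded in L^2_loc, so
   near-minimizers of an exhausting family of quadratic forms converge, by the
   parallelogram law, to a Gamma satisfying all constraints. *)
Require Import Defs.
From mathcomp Require Import all_boot all_order all_algebra.
From mathcomp Require Import all_classical all_reals all_analysis.
From mathcomp Require Import measurable_realfun ring lra.

Set Implicit Arguments.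
Unset Strict Implicit.
Unset Printing Implicit Defensive.

Import Order.TTheory GRing.Theory Num.Theory.
Import numFieldNormedType.Exports.

Local Open Scope classical_set_scope.
Local Open Scope ring_scope.

(** * Smooth functions *)

Section directional_chain_rule.
Context {R : realType} {V : normedModType R}.
Implicit Types (u : V -> R) (g : R -> R) (x v : V).

(** As [sigma] is a mere distribution, without sign or regularity, the field is not sought through a
    positive solution of a differential equation. Everything before the final limit uses continuous
    fields only, whose products with test functions are integrable; L^2_loc fields appear only as
    limits. The term |Gamma|^2 phi is not weakly continuous, so the limit must be strong: the
    near-minimizers are chosen to converge so fast that they converge almost everywhere under a
    common majorant of their squares, and dominated convergence applies. The constraints are indexed
    by uncountably many phi, yet one sequence suffices. The minimal values over finite sets of
    constraints have a supremum, reached along a sequence of indices; imposing one further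
    constraint then moves a near-minimizer by an amount tending to 0, and so does not change the
    limit. *)

Lemma derive_line (W : normedModType R) (f : V -> W) x v :
  'D_v f x = 'D_1 (fun h : R => f (h *: v + x)) 0.
Proof.
rewrite /derive (_ : (fun h => h^-1 *: ((_ \o shift 0) _ - _)) =
  fun h => h^-1 *: ((f \o shift x) (h *: v) - f x))//.
by apply/funext => h /=; rewrite addr0 scale0r add0r [_%:A]mulr1.
Qed.

(** The notion [smooth] speaks of directional derivatives only. Hence [u] is assumed derivable along
    [v] alone, and the chain rule is that of one variable on the line through [x]. *)
Lemma is_derive_comp1 u g x v (a b : R) :
  is_derive (u x) 1 g a -> is_derive x v u b -> is_derive x v (g \o u) (a * b).
Proof.
move=> gax [du <-].
have ux : is_derive (0 : R) 1 (fun h : R => u (h *: v + x)) ('D_v u x).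
  by apply: DeriveDef; [move/derivable1P: du|rewrite -derive_line].
have e : u ((0 : R) *: v + x) = u x by rewrite scale0r add0r.
have gax' : is_derive ((fun h : R => u (h *: v + x)) 0) 1 g a by rewrite /= e.
have [d1 d2] := is_derive1_comp gax' ux.
by apply: DeriveDef; [apply/derivable1P|rewrite derive_line].
Qed.

End directional_chain_rule.

Section smooth_calculus.
Context {R : realType} {n : nat}.
Local Notation V := 'rV[R]_n.
Implicit Types (f g u : V -> R) (k : nat) (i : 'I_n).
Local Notation e i := (delta_mx ord0 i : V).

(* [smooth] cut at order [k]: unlike [smooth], it is amenable to induction. *)
Fixpoint Ck k f : Prop :=
  if k is k'.+1 then
    [/\ continuous f, forall i x, derivable f x (e i) &
        forall i, Ck k' (partial i f)]
  else continuous f.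

Lemma smooth_partial f i : smooth f -> smooth (partial i f).
Proof. by move=> sf s; have := sf (rcons s i); rewrite /partials foldr_rcons. Qed.

(** [partials] differentiates first along the last direction of the list, and [Ck] peels off the
    first derivative; hence the induction from the right end. *)
Lemma smoothP f : smooth f <-> forall k, Ck k f.
Proof.
split=> [+ k|].
  elim: k f => [|k IH] f sf /=; first by have [] := sf [::].
  have [cf df] := sf [::]; split => // i.
  exact/IH/smooth_partial.
move=> + s; elim/last_ind: s f => [|s i IH] f Cf.
  by have [] := Cf 1.
rewrite /partials foldr_rcons; apply: IH => k.
by have [_ _] := Cf k.+1; apply.
Qed.

Lemma CkW k f : Ck k.+1 f -> Ck k f.
Proof.
elim: k f => [|k IH] f; first by move=> [].
by move=> [cf df pf]; split => // i; exact/IH/pf.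
Qed.

Lemma smooth_continuous f : smooth f -> continuous f.
Proof. by move/(_ [::]) => []. Qed.

Lemma smooth_derivable f i x : smooth f -> derivable f x (e i).
Proof. by move/(_ [::]) => []. Qed.

Lemma smooth_continuous_partial f i : smooth f -> continuous (partial i f).
Proof. by move/(_ [:: i]) => []. Qed.

Lemma Ck_cst k (c : R) : Ck k (fun=> c).
Proof.
elim: k c => [|k IH] c; first exact: cst_continuous.
split => [|i x|i]; [exact: cst_continuous|exact: derivable_cst|].
rewrite (_ : partial i _ = fun=> 0); first exact: IH.
by apply/funext => x; rewrite /partial derive_cst.
Qed.

Lemma CkD k f g : Ck k f -> Ck k g -> Ck k (fun x => f x + g x).
Proof.
elim: k f g => [|k IH] f g.
  by move=> cf cg x; exact: (continuousD (cf x) (cg x)).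
move=> [cf df pf] [cg dg pg]; split => [x|i x|i].
- exact: (continuousD (cf x) (cg x)).
- exact: derivableD.
- rewrite (_ : partial i _ = fun x => partial i f x + partial i g x).
    exact: (IH _ _ (pf i) (pg i)).
  by apply/funext => x; rewrite /partial deriveD.
Qed.

Lemma CkM k f g : Ck k f -> Ck k g -> Ck k (fun x => f x * g x).
Proof.
elim: k f g => [|k IH] f g.
  by move=> cf cg x; exact: (continuousM (cf x) (cg x)).
move=> Cf Cg; have [cf df pf] := Cf; have [cg dg pg] := Cg.
split => [x|i x|i].
- exact: (continuousM (cf x) (cg x)).
- exact: derivableM.
- rewrite (_ : partial i _ =
      fun x => f x * partial i g x + g x * partial i f x).
    exact: (CkD (IH _ _ (CkW Cf) (pg i)) (IH _ _ (CkW Cg) (pf i))).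
  by apply/funext => x; rewrite /partial deriveM.
Qed.

Lemma CkV k f : (forall x, f x != 0) -> Ck k f -> Ck k (fun x => (f x)^-1).
Proof.
move=> f0; elim: k => [|k IH].
  by move=> cf x; exact: (continuousV (f0 x) (cf x)).
move=> Cf; have [cf df pf] := Cf.
split => [x|i x|i].
- exact: (continuousV (f0 x) (cf x)).
- exact: derivableV.
- rewrite (_ : partial i _ =
      fun x => (-1) * (((f x)^-1 * (f x)^-1) * partial i f x)).
    have Cv := IH (CkW Cf).
    exact: (CkM (Ck_cst _ _) (CkM (CkM Cv Cv) (pf i))).
  apply/funext => x; rewrite /partial deriveV// mulN1r scaleNr.
  by rewrite expr2 invfM.
Qed.

Lemma Ck_sqrt k f : (forall x, 0 < f x) -> Ck k f -> Ck k (fun x => Num.sqrt (f x)).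
Proof.
move=> f0; have d i x : derivable f x (e i) ->
    is_derive x (e i) (Num.sqrt \o f) ((2 * Num.sqrt (f x))^-1 * partial i f x).
  by move=> df; apply: is_derive_comp1; [exact: is_derive1_sqrt|exact: derivableP].
have c : continuous f -> continuous (fun x => Num.sqrt (f x)).
  by move=> cf x; apply: continuous_comp; [exact: cf|exact: sqrt_continuous].
elim: k => [//|k IH] Cf; have [cf df pf] := Cf.
split => [|i x|i]; first exact: c.
  by have [] := d i x (df i x).
rewrite (_ : partial i _ = fun x => (2 * Num.sqrt (f x))^-1 * partial i f x).
  apply: (CkM _ (pf i)); apply: CkV => [x|].
    by rewrite mulf_neq0// gt_eqF// sqrtr_gt0.
  exact: (CkM (Ck_cst _ _) (IH (CkW Cf))).
by apply/funext => x; have [_] := d i x (df i x).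
Qed.

(** The hypothesis has the shape of the derivation rule of [flat], with [a j = - j]. The induction
    on [k] closes because all members of the family are treated at once. *)
Lemma Ck_comp k (g : nat -> R -> R) (a : nat -> R) u :
  (forall j (t : R), is_derive t 1 (g j) (a j * g j.+1 t + g j.+2 t)) ->
  Ck k u -> forall j, Ck k (fun x => g j (u x)).
Proof.
move=> dg; have cg j : continuous (g j).
  by move=> t; apply/differentiable_continuous/derivable1_diffP; have [] := dg j t.
have c j : continuous u -> continuous (fun x => g j (u x)).
  by move=> cu x; apply: continuous_comp; [exact: cu|exact: cg].
elim: k => [cu j|k IH Cu j]; first exact: c.
have [cu du pu] := Cu.
have d i x : is_derive x (e i) (g j \o u)
    ((a j * g j.+1 (u x) + g j.+2 (u x)) * partial i u x).
  exact: (is_derive_comp1 (dg j (u x)) (derivableP (du i x))).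
split => [|i x|i]; [exact: c|by have [] := d i x|].
rewrite (_ : partial i _ =
  fun x => (a j * g j.+1 (u x) + g j.+2 (u x)) * partial i u x).
  have Ck' j' := IH (CkW Cu) j'.
  exact: (CkM (CkD (CkM (Ck_cst _ _) (Ck' _)) (Ck' _)) (pu i)).
by apply/funext => x; have [_] := d i x.
Qed.

Lemma Ck_coord k i : Ck k (fun x : V => x ord0 i).
Proof.
have d j x : is_derive x (e j) (fun x : V => x ord0 i) ((i == j)%:R : R).
  have dV := @derivable_id R 'rV[R]_n x (e j).
  have dd := (derivable_mxP _ _ _).1 dV ord0 i.
  apply: DeriveDef => //.
  have := derive_mx dV.
  by rewrite derive_id => /matrixP/(_ ord0 i); rewrite !mxE eqxx /= => <-.
have c : continuous (fun x : V => x ord0 i) by exact: coord_continuous.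
case: k => [//|k]; split => [//|j x|j]; first by have [] := d j x.
rewrite (_ : partial j _ = fun=> (i == j)%:R); first exact: Ck_cst.
by apply/funext => x; have [_] := d j x.
Qed.

Lemma smooth_cst (c : R) : smooth (cst c : V -> R).
Proof. by apply/smoothP => k; exact: Ck_cst. Qed.

Lemma smoothD f g : smooth f -> smooth g -> smooth (fun x => f x + g x).
Proof. by move=> /smoothP sf /smoothP sg; apply/smoothP => k; exact: CkD. Qed.

Lemma smoothM f g : smooth f -> smooth g -> smooth (fun x => f x * g x).
Proof. by move=> /smoothP sf /smoothP sg; apply/smoothP => k; exact: CkM. Qed.

Lemma smoothV f : (forall x, f x != 0) -> smooth f -> smooth (fun x => (f x)^-1).
Proof. by move=> f0 /smoothP sf; apply/smoothP => k; exact: CkV. Qed.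

Lemma smooth_sqrt f : (forall x, 0 < f x) -> smooth f ->
  smooth (fun x => Num.sqrt (f x)).
Proof. by move=> f0 /smoothP sf; apply/smoothP => k; exact: Ck_sqrt. Qed.

Lemma smooth_coord i : smooth (fun x : V => x ord0 i).
Proof. by apply/smoothP => k; exact: Ck_coord. Qed.

Lemma smooth_sum (I : Type) (s : seq I) (F : I -> V -> R) :
  (forall j, smooth (F j)) -> smooth (fun x => \sum_(j <- s) F j x).
Proof.
move=> sF; elim: s => [|j s IH].
  rewrite (_ : (fun _ => _) = fun=> 0); first exact: smooth_cst.
  by apply/funext => x; rewrite big_nil.
rewrite (_ : (fun _ => _) = fun x => F j x + \sum_(j <- s) F j x).
  exact: (smoothD (sF j) IH).
by apply/funext => x; rewrite big_cons.
Qed.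

Lemma smooth_prod (I : Type) (s : seq I) (F : I -> V -> R) :
  (forall j, smooth (F j)) -> smooth (fun x => \prod_(j <- s) F j x).
Proof.
move=> sF; elim: s => [|j s IH].
  rewrite (_ : (fun _ => _) = fun=> 1); first exact: smooth_cst.
  by apply/funext => x; rewrite big_nil.
rewrite (_ : (fun _ => _) = fun x => F j x * \prod_(j <- s) F j x).
  exact: (smoothM (sF j) IH).
by apply/funext => x; rewrite big_cons.
Qed.

Lemma partialD f g i x : smooth f -> smooth g ->
  partial i (fun x => f x + g x) x = partial i f x + partial i g x.
Proof. by move=> sf sg; rewrite /partial deriveD//; exact: smooth_derivable. Qed.

Lemma partialM f g i x : smooth f -> smooth g ->
  partial i (fun x => f x * g x) x = f x * partial i g x + g x * partial i f x.
Proof. by move=> sf sg; rewrite /partial deriveM//; exact: smooth_derivable. Qed.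

Lemma partial_cst (c : R) i x : partial i (cst c) x = 0.
Proof. by rewrite /partial derive_cst. Qed.

Lemma partialZ f (c : R) i x : smooth f ->
  partial i (fun x => c * f x) x = c * partial i f x.
Proof.
by move=> sf; rewrite (partialM _ _ (smooth_cst c) sf) partial_cst mulr0 addr0.
Qed.

Lemma partial_sqrt f i x : (forall x, 0 < f x) -> smooth f ->
  partial i (fun x => Num.sqrt (f x)) x = (2 * Num.sqrt (f x))^-1 * partial i f x.
Proof.
move=> f0 sf.
have [_ <-] // := @is_derive_comp1 _ _ f Num.sqrt x (e i) _ _
  (is_derive1_sqrt (f0 x)) (derivableP (@smooth_derivable f i x sf)).
Qed.

End smooth_calculus.

Section flat_function.
Context {R : realType}.

(* The factor [t ^- j] closes the family under derivation, so that smoothness needs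
   no induction on polynomials in [t^-1]. *)
Definition flat (j : nat) (t : R) : R :=
  if 0 < t then t ^- j * expR (- t^-1) else 0.

Lemma flat_ge0 j t : 0 <= flat j t.
Proof.
rewrite /flat; case: ltP => // t0.
by rewrite mulr_ge0// ?expR_ge0// invr_ge0 exprn_ge0// ltW.
Qed.

Lemma flat_gt0 j t : (0 < flat j t) = (0 < t).
Proof.
rewrite /flat; case: (ltP 0 t) => t0; last by rewrite ltxx.
by rewrite mulr_gt0 ?expR_gt0// invr_gt0 exprn_gt0.
Qed.

(** A single term of the exponential series at [t^-1], that of degree [j + 2], beats the pole
    [t ^- j] with two powers of [t] to spare: this is what makes the derivative at the origin exist
    and vanish. *)
Lemma flat_le j t : 0 < t -> flat j t <= (j.+2)`!%:R * t ^+ 2.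
Proof.
move=> t0; rewrite /flat t0 expRN.
have ti : 0 <= t^-1 by rewrite invr_ge0 ltW.
have := expR_ge1Dxn j.+1 ti.
set E := expR _ => h.
have fac : 0 < (j.+2)`!%:R :> R by rewrite ltr0n fact_gt0.
have : t^-1 ^+ j.+2 <= (j.+2)`!%:R * E.
  rewrite mulrC -ler_pdivrMr//; apply: le_trans h; by rewrite lerDr.
have E0 : 0 < E by exact: expR_gt0.
move=> h2; rewrite -ler_pdivlMr ?invr_gt0// invrK.
rewrite exprVn -(ler_pM2r (exprn_gt0 2 t0)) in h2.
rewrite [leRHS]mulrAC; apply: le_trans h2.
by rewrite -[j.+2]addn2 exprD invfM mulfVK// expf_neq0// gt_eqF.
Qed.

Lemma is_derive_flat j (t : R) :
  is_derive t 1 (flat j) (- j%:R * flat j.+1 t + flat j.+2 t).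
Proof.
have [t0|t0|->] := ltgtP t 0.
- rewrite /flat ltNge (ltW t0)/= mulr0 addr0.
  apply: (@near_eq_is_derive _ _ _ (cst 0)).
  by near=> s; rewrite ltNge ltW//; near: s; exact: lt_nbhsl.
- pose h (s : R) := (s ^+ j)^-1 * expR (- s^-1).
  apply: (@near_eq_is_derive _ _ _ h).
    near=> s; rewrite /flat ifT//; near: s; exact: lt_nbhsr.
  have tn0 : t != 0 by rewrite gt_eqF.
  have tj0 : t ^+ j != 0 by rewrite expf_neq0.
  have d1 : is_derive t 1 (fun s : R => (s ^+ j)^-1)
     (- (t ^+ j) ^- 2 *: (j%:R * t ^+ j.-1)).
    apply: (@is_deriveV _ (fun s => s ^+ j)) => //.
    by apply: DeriveDef; [exact: exprn_derivable|rewrite exp_derive [LHS]mulr1].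
  have d2 : is_derive t 1 (fun s : R => - s^-1) (- (- t ^- 2 *: 1)).
    by apply: is_deriveN; apply: (@is_deriveV _ id).
  have d3 := @is_derive1_comp _ expR (fun s : R => - s^-1) t _ _
    (is_derive_expR (- t^-1)) d2.
  have d4 := is_deriveM d1 d3.
  apply: (is_derive_eq d4).
  rewrite /flat t0 /= /GRing.scale /=.
  set E := expR _; clear -tn0.
  (* The derivative of [s ^+ j] carries the truncated exponent [j.-1], so [j = 0] is separated. *)
  case: j => [|j] /=; first by rewrite !expr0 expr1; field.
  rewrite !exprS; have : t ^+ j != 0 by rewrite expf_neq0.
  by move: (t ^+ j) => T T0; field; rewrite T0.
- rewrite /flat ltxx mulr0 addr0.
  have b : forall s : R, `|flat j s| <= (j.+2)`!%:R * s ^+ 2.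
    move=> s; rewrite ger0_norm ?flat_ge0//.
    have [s0|s0] := ltP 0 s; first exact: flat_le.
    by rewrite /flat ltNge s0/= mulr_ge0// sqr_ge0.
  have c : (fun h : R => h^-1 *: ((flat j \o shift 0) (h *: 1) - flat j 0)) @ 0^'
      --> (0 : R).
    apply/cvgrPdist_le => e e0.
    near=> h.
    have h0 : h != 0 by near: h; exact: nbhs_dnbhs_neq.
    rewrite sub0r normrN /= addr0 [_%:A]mulr1 {2}/flat ltxx subr0 normrZ.
    apply: (@le_trans _ _ (`|h^-1| * ((j.+2)`!%:R * h ^+ 2))).
      by rewrite ler_wpM2l// b.
    have -> : `|h^-1| * ((j.+2)`!%:R * h ^+ 2) = (j.+2)`!%:R * `|h|.
      rewrite normfV -real_normK ?num_real//; have : `|h| != 0 by rewrite normr_eq0.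
      by move=> ?; field.
    have fac : 0 < (j.+2)`!%:R :> R by rewrite ltr0n fact_gt0.
    rewrite mulrC -ler_pdivlMr//; near: h.
    by apply: dnbhs0_le; exact: divr_gt0.
  apply: DeriveDef; first by apply/cvg_ex; exists 0.
  exact: cvg_lim.
Unshelve. all: by end_near. Qed.

Lemma smooth_flat n (u : 'rV[R]_n -> R) j : smooth u -> smooth (fun x => flat j (u x)).
Proof.
move=> /smoothP su; apply/smoothP => k.
exact: (@Ck_comp _ _ k flat (fun j => - j%:R) u (fun j t => is_derive_flat j t)).
Qed.

End flat_function.

(** * Cutoff functions and compact exhaustions *)

Section test_functions.
Context {R : realType} {n : nat}.
Local Notation V := 'rV[R]_n.
Implicit Types (f g : V -> R) (Omega K C : set V).

Lemma supp_subset f C : closed C -> (forall x, f x != 0 -> C x) -> supp f `<=` C.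
Proof. by move=> cC fC; rewrite /supp closureE => x; apply; split. Qed.

Lemma supp_neq0 f x : f x != 0 -> supp f x.
Proof. exact: (@subset_closure _ [set x | f x != 0] x). Qed.

Lemma supp_eq0 f x : ~ supp f x -> f x = 0.
Proof. by move=> nfx; apply: contra_notP nfx => /eqP; exact: supp_neq0. Qed.

Lemma test_function_supp f g Omega : smooth g -> test_function Omega f ->
  (forall x, g x != 0 -> supp f x) -> test_function Omega g.
Proof.
move=> sg [sf cf fO] gf.
have gsf : supp g `<=` supp f by apply: supp_subset => //; exact: closed_closure.
split => //; last exact: subset_trans fO.
exact: (subclosed_compact (@closed_closure _ _) cf).
Qed.

Lemma test_functionM f g Omega : smooth g -> test_function Omega f ->
  test_function Omega (fun x => g x * f x).
Proof.
move=> sg tf; have [sf _ _] := tf.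
apply: (test_function_supp (smoothM sg sf) tf) => x.
by rewrite mulf_eq0 negb_or => /andP[_ fx]; exact: supp_neq0.
Qed.

Lemma test_functionZ f (a : R) Omega : test_function Omega f ->
  test_function Omega (fun x => a * f x).
Proof. exact: (test_functionM (smooth_cst a)). Qed.

Lemma test_function_sqr f Omega : test_function Omega f ->
  test_function Omega (fun x => f x ^+ 2).
Proof. by move=> tf; have [sf _ _] := tf; exact: (test_functionM sf tf). Qed.

Lemma test_functionD f g Omega : test_function Omega f -> test_function Omega g ->
  test_function Omega (fun x => f x + g x).
Proof.
move=> [sf cf fO] [sg cg gO]; split; first exact: smoothD.
  have fg : supp (fun x => f x + g x) `<=` supp f `|` supp g.
    apply: supp_subset; first by apply: closedU; exact: closed_closure.
    move=> x fgx; apply: contrapT => /not_orP[/supp_eq0 fx /supp_eq0 gx].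
    by move: fgx; rewrite fx gx addr0 eqxx.
  exact: (subclosed_compact (@closed_closure _ _) (compactU cf cg)).
apply: (@subset_trans _ (supp f `|` supp g)); last by rewrite subUset.
apply: supp_subset; first by apply: closedU; exact: closed_closure.
move=> x fgx; apply: contrapT => /not_orP[/supp_eq0 fx /supp_eq0 gx].
by move: fgx; rewrite fx gx addr0 eqxx.
Qed.

Lemma test_function_sum Omega (I : Type) (s : seq I) (F : I -> V -> R) :
  (forall i, test_function Omega (F i)) ->
  test_function Omega (fun x => \sum_(i <- s) F i x).
Proof.
move=> tF; elim: s => [|j s IH].
  rewrite (_ : (fun _ => _) = cst 0); last first.
    by apply/funext => x; rewrite big_nil.
  have s0 : supp (cst 0 : V -> R) = set0.
    rewrite /supp (_ : [set x | _] = set0) ?closure0// -subset0 => x /=.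
    by rewrite eqxx.
  by split; [exact: smooth_cst|rewrite s0; exact: compact0|rewrite s0].
rewrite (_ : (fun _ => _) = fun x => F j x + \sum_(j <- s) F j x).
  exact: (test_functionD (tF j) IH).
by apply/funext => x; rewrite big_cons.
Qed.

Lemma partial_supp i f x : ~ supp f x -> partial i f x = 0.
Proof.
move=> nfx; rewrite /partial.
have -> : 'D_(delta_mx ord0 i) f x = 'D_(delta_mx ord0 i) (cst 0 : V -> R) x.
  apply: near_eq_derive.
  have : open (~` supp f) by apply: closed_openC; exact: closed_closure.
  rewrite openE => /(_ x nfx); apply: filterS => y; exact: supp_eq0.
exact: derive_cst.
Qed.

(** A zero of a nonnegative function is a minimum on every line through it. In [riccati_test_field]
    this disposes of the points where [phi] vanishes and the cutoff need not be locally constant. *)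
Lemma partial_eq0 i f x : smooth f -> (forall y, 0 <= f y) -> f x = 0 ->
  partial i f x = 0.
Proof.
move=> sf f0 fx.
pose g (h : R) := f (h *: delta_mx ord0 i + x).
have dg h : derivable g h 1.
  apply/derivable1P.
  rewrite (_ : (fun k => _) =
     (fun k : R => f (k *: delta_mx ord0 i + (h *: delta_mx ord0 i + x)))).
    by apply: (derivable1P _ _ _).1; exact: smooth_derivable.
  apply/funext => k; rewrite /g; congr (f _).
  by rewrite addrA -scalerDl [_%:A]mulr1.
have : is_derive (0 : R) 1 g 0.
  apply: (@derive1_at_min _ g (-1) 1 0); rewrite ?in_itv/= ?ltrN10 ?ltr01//.
  by move=> t _; rewrite /g scale0r add0r fx f0.
by rewrite /partial derive_line => -[_].
Qed.

(** A product over the coordinates is positive exactly on an open cube, which is the ball of the sup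
    norm. *)
Definition bump (a : V) (r : R) (x : V) : R :=
  \prod_(i < n) (flat 0 (r - (x ord0 i - a ord0 i)) *
                 flat 0 (r + (x ord0 i - a ord0 i))).

Lemma bump_ge0 a r x : 0 <= bump a r x.
Proof. by apply: prodr_ge0 => i _; rewrite mulr_ge0// flat_ge0. Qed.

Lemma smooth_bump a r : smooth (bump a r).
Proof.
apply: smooth_prod => i; apply: smoothM; apply: smooth_flat.
  rewrite (_ : (fun _ => _) = fun x : V => (r + a ord0 i) + (-1) * x ord0 i).
    apply: (smoothD (smooth_cst _)).
    exact: (smoothM (smooth_cst _) (smooth_coord i)).
  by apply/funext => x; ring.
rewrite (_ : (fun _ => _) = fun x : V => (r - a ord0 i) + x ord0 i).
  exact: (smoothD (smooth_cst _) (smooth_coord i)).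
by apply/funext => x; ring.
Qed.

Lemma bump_gt0 a r x : 0 < r -> (0 < bump a r x) = (`|a - x| < r).
Proof.
move=> r0; rewrite /bump; apply/idP/idP => [b|axr].
  have : ball a r x.
    split => // i j; rewrite ord1.
    have : flat 0 (r - (x ord0 j - a ord0 j)) * flat 0 (r + (x ord0 j - a ord0 j)) != 0.
      by move/lt0r_neq0/prodf_neq0 : b; exact.
    have p (t : R) : flat 0 t != 0 -> 0 < t.
      by move=> ft; rewrite -(flat_gt0 0) lt0r ft flat_ge0.
    rewrite /ball/= mulf_eq0 negb_or => /andP[/p h1 /p h2].
    by rewrite ltr_norml; lra.
  by rewrite -ball_normE.
apply: prodr_gt0 => i _.
have : ball a r x by rewrite -ball_normE.
move=> [_ /(_ ord0 i)]; rewrite /ball/= ltr_norml => /andP[h1 h2].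
by rewrite mulr_gt0// flat_gt0; lra.
Qed.

Lemma compact_closed_ball (a : V) (r : R) : compact [set x | `|a - x| <= r].
Proof.
apply: bounded_closed_compact; last exact: (@closed_closed_ball_ _ _ a r).
exists (`|a| + r); split; first exact: num_real.
move=> M Mr x /= axr; apply: ltW; apply: le_lt_trans Mr.
have -> : x = a - (a - x) by rewrite opprB addrC subrK.
by apply: (le_trans (ler_normB _ _)); rewrite lerD2l.
Qed.

Lemma open_ball_subset Omega x : open Omega -> Omega x ->
  exists2 r : R, 0 < r & forall y, `|x - y| <= r -> Omega y.
Proof.
rewrite openE => /(_ x) + Ox => /(_ Ox).
rewrite /interior /= -nbhs_ballE => -[r /= r0 xr].
exists (r / 2); first by rewrite divr_gt0.
move=> y xy; apply: xr; rewrite -ball_normE /=; apply: le_lt_trans xy _.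
by rewrite ltr_pdivrMr// ltr_pMr// ltr1n.
Qed.

Lemma smooth_urysohn Omega K : open Omega -> compact K -> K `<=` Omega ->
  exists psi, [/\ test_function Omega psi, forall x, 0 <= psi x &
    forall x, K x -> psi x = 1].
Proof.
move=> oO cK KO.
(* Outside [Omega] the radius is a default value, so that [r] is a total positive function; only
   centres in [K] are used. *)
have rex x : exists r : R, 0 < r /\ (Omega x -> forall y, `|x - y| <= r -> Omega y).
  have [Ox|nOx] := pselect (Omega x); last by exists 1.
  by have [r r0 rO] := open_ball_subset oO Ox; exists r.
pose r x : R := projT1 (cid (rex x)).
have r0 x : 0 < r x by rewrite /r; case: cid => ? [].
have rO x : Omega x -> forall y, `|x - y| <= r x -> Omega y.
  by rewrite /r; case: cid => ? [].
have := cK; rewrite compact_cover => /(_ V K (fun x => [set y | 0 < bump x (r x) y])).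
case.
- move=> x Kx; apply: (@open_comp _ _ (bump x (r x)) [set t | 0 < t]).
    by move=> y _; exact: (smooth_continuous (smooth_bump _ _)).
  exact: open_gt.
- by move=> x Kx; exists x => //=; rewrite bump_gt0// subrr normr0.
move=> D' DK KD; pose D : seq V := finmap.enum_fset D'.
pose S x := \sum_(a <- D) bump a (r a) x.
have sS : smooth S by apply: smooth_sum => a; exact: smooth_bump.
have S0 x : 0 <= S x by apply: sumr_ge0 => a _; exact: bump_ge0.
have SK x : K x -> 0 < S x.
  move=> /KD[a /= aD ax]; rewrite /S (perm_big _ (@perm_to_rem _ a D aD)) big_cons.
  by rewrite ltr_wpDr// sumr_ge0// => b _; exact: bump_ge0.
have [c c0 Kc] : exists2 c : R, 0 < c & forall x, K x -> c <= S x.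
  have [->|/set0P K0] := eqVneq K set0; first by exists 1.
  have cS : {within K, continuous S}.
    by apply: continuous_subspaceT; exact: smooth_continuous.
  have [z /[!inE] Kz zmin] := compact_EVT_min K0 cK cS.
  by exists (S z); [exact: SK|move=> x Kx; apply: zmin; rewrite inE].
(* The quotient of [S] by itself is undefined where [S] vanishes. The added term is positive when
   [S < c] and zero when [S >= c]: the denominator never vanishes, and it equals [S] on [K]. *)
pose den x := S x + flat 0 (1 + (- c^-1) * S x).
have den0 x : den x != 0.
  rewrite gt_eqF// /den; have := S0 x; rewrite le_eqVlt => /orP[/eqP <-|Sx].
    by rewrite mulr0 addr0 add0r flat_gt0 ltr01.
  by rewrite ltr_wpDr// flat_ge0.
have sden : smooth den.
  apply: (smoothD sS); apply: smooth_flat.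
  exact: (smoothD (smooth_cst _) (smoothM (smooth_cst _) sS)).
exists (fun x => (den x)^-1 * S x).
pose C : set V := \big[setU/set0]_(a <- D) [set y | `|a - y| <= r a].
have cC : compact (C : set V).
  apply: (big_ind (fun A : set V => compact A)); first exact: compact0.
    by move=> A B; exact: compactU.
  by move=> a _; exact: compact_closed_ball.
have suppC : supp (fun x => (den x)^-1 * S x) `<=` C.
  apply: supp_subset => [|x]; first exact: compact_closed.
  rewrite mulf_eq0 negb_or => /andP[_ Sx].
  rewrite /C -bigcup_seq; apply: contrapT => nC; move/eqP: Sx; apply.
  rewrite /S big_seq big1// => a aD.
  apply/eqP; rewrite eq_le bump_ge0 andbT leNgt bump_gt0//; apply/negP => h.
  by apply: nC; exists a => //=; exact: ltW.
split.
- split; first exact: (smoothM (smoothV den0 sden) sS).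
    exact: (subclosed_compact (@closed_closure _ _) cC).
  apply: (subset_trans suppC); rewrite /C -bigcup_seq => x [a /= aD ax].
  by apply: (rO a) => //; apply: KO; have := DK a aD; rewrite inE.
- by move=> x; rewrite mulr_ge0// invr_ge0 addr_ge0// flat_ge0.
- move=> x Kx; have := den0 x; rewrite /den {1 2}/flat ifF ?addr0.
    by move=> Sx; rewrite mulVf.
  apply/negbTE; rewrite -leNgt mulNr subr_le0 mulrC ler_pdivlMr// mul1r.
  exact: Kc.
Qed.

(** The distance condition is stated point by point, which avoids the distance to a complement that
    is empty when [Omega] is the whole space. *)
Definition exhaust Omega (j : nat) : set V :=
  [set x | `|x| <= j%:R /\ forall y, ~ Omega y -> j.+1%:R^-1 <= `|y - x|].

Lemma exhaust_compact Omega j : compact (exhaust Omega j).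
Proof.
apply: (@subclosed_compact _ _ [set x : V | `|0 - x| <= j%:R]).
- have -> : exhaust Omega j = [set x | `|x| <= j%:R] `&`
     \bigcap_(y in ~` Omega) [set x | j.+1%:R^-1 <= `|y - x|].
    by apply/seteqP; split => x [].
  apply: closedI.
    rewrite (_ : [set x | _] = [set x : V | `|0 - x| <= j%:R]).
      exact: (@closed_closed_ball_ _ V 0 j%:R).
    by apply/seteqP; split => x /=; rewrite sub0r normrN.
  apply: closed_bigI => y _.
  rewrite (_ : [set x | _] = ~` [set x | `|y - x| < j.+1%:R^-1]).
    apply: open_closedC; rewrite -[X in open X]/(ball_ Num.norm y _) ball_normE.
    exact: ball_open.
  by apply/seteqP; split => x /=; rewrite leNgt => /negP.
- exact: compact_closed_ball.
- by move=> x [+ _] /=; rewrite sub0r normrN.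
Qed.

Lemma exhaust_sub Omega j : exhaust Omega j `<=` Omega.
Proof.
move=> x [_ h]; apply: contrapT => /h; rewrite subrr normr0 invr_le0.
by rewrite leNgt ltr0n.
Qed.

Lemma exhaust_ge Omega K : open Omega -> compact K -> K `<=` Omega ->
  exists j, forall k, (j <= k)%N -> K `<=` exhaust Omega k.
Proof.
move=> oO cK KO.
suff [j _ jP] : \forall j \near \oo, K `<=` exhaust Omega j.
  by exists j => k jk; exact: (jP k).
move/compact_near_coveringP : cK; apply => x Kx.
have [r r0 rO] := open_ball_subset oO (KO x Kx).
(* The bound 1 controls the norm of [x']; the bound [r / 2] leaves the other half of [r] for the
   distance from [x'] to the complement. *)
have hb : nbhs x [set x' : V | `|x - x'| < Num.min 1 (r / 2)].
  rewrite -[X in nbhs _ X]/(ball_ Num.norm x _) ball_normE.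
  by apply: nbhsx_ballx; rewrite lt_min ltr01 divr_gt0.
near=> x' j => /=.
have xx' : `|x - x'| < Num.min 1 (r / 2) by near: x'.
move: xx'; rewrite lt_min => /andP[x1 x2].
split.
  apply: (@le_trans _ _ (`|x| + 1)).
    have -> : x' = x - (x - x') by rewrite opprB addrC subrK.
    by apply: (le_trans (ler_normB _ _)); rewrite lerD2l ltW.
  by near: j; exact: nbhs_infty_ger.
move=> y nOy; rewrite leNgt; apply/negP => h; apply: nOy; apply: rO.
have -> : x - y = (x - x') - (y - x') by rewrite opprB addrA subrK.
apply: (le_trans (ler_normB _ _)).
have : j.+1%:R^-1 <= r / 2.
  near: j; have : 0 < r / 2 by rewrite divr_gt0.
  move=> r20; apply: filterS (near_infty_natSinv_lt (PosNum r20)) => k.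
  exact: ltW.
by move: x2 h; move: (`|x - x'|) (`|y - x'|) (j.+1%:R^-1); move=> *; lra.
Unshelve. all: by end_near. Qed.

End test_functions.

(** * Borel sets and integrability on R^n *)

Section borel_rV.
Context {R : realType} {n : nat}.
Local Notation V := 'rV[R]_n.
Local Notation mu := (lebesgue_rV R n).
Implicit Types (f g : V -> R) (Omega K : set V).

Lemma measurable_box (P : 'I_n -> set R) : (forall i, measurable (P i)) ->
  measurable [set x : V | forall i, P i (x ord0 i)].
Proof.
move=> mP.
rewrite (_ : [set x | _] = \bigcap_(i in [set: 'I_n]) [set x : V | P i (x ord0 i)]).
  apply: fin_bigcap_measurable; first exact: finite_finset.
  move=> i _; rewrite -[X in measurable X]setTI.
  exact: (@measurable_coord _ R n i measurableT (P i) (mP i)).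
by apply/seteqP; split => x /=; [move=> + i _; apply|move=> + i; exact].
Qed.

(** The sigma-algebra is generated by the coordinates, so an open set has to be written as a
    countable union of rational boxes. A box of half-width below [r / 2] whose centre is that close
    to [x] stays in the ball of radius [r] about [x]. *)
Lemma open_measurable_rV (A : set V) : open A -> measurable A.
Proof.
move=> oA.
pose box (p : 'rV[rat]_n * nat) : set V :=
  [set x | forall i, `](ratr (p.1 ord0 i) - p.2.+1%:R^-1),
                       (ratr (p.1 ord0 i) + p.2.+1%:R^-1)[%classic (x ord0 i)].
have -> : A = \bigcup_p (if pselect (box p `<=` A) then box p else set0).
  apply/seteqP; split => [x Ax|x [p _]]; last by case: pselect => //= h; exact: h.
  have [r r0 rA] := open_ball_subset oA Ax.
  have r20 : 0 < r / 2 by rewrite divr_gt0.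
  have [m mr] : exists m : nat, m.+1%:R^-1 < r / 2.
    have [m _ mP] := near_infty_natSinv_lt (PosNum r20).
    by exists m; exact: (mP m (leqnn m)).
  have m0 : 0 < m.+1%:R^-1 :> R by rewrite invr_gt0 ltr0n.
  have qex i : exists q : rat, `|x ord0 i - ratr q| < m.+1%:R^-1.
    have /rat_in_itvoo[q] : x ord0 i < x ord0 i + m.+1%:R^-1 by rewrite ltrDl.
    rewrite in_itv/= => /andP[q1 q2]; exists q.
    by rewrite ler0_norm ?subr_le0 ?ltW// opprB ltrBlDl.
  pose q : 'rV[rat]_n := \row_i projT1 (cid (qex i)).
  have qx i : `|x ord0 i - ratr (q ord0 i)| < m.+1%:R^-1.
    by rewrite mxE; case: cid.
  exists (q, m) => //; case: pselect => /= [_ i|[]].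
    move: (qx i); rewrite distrC ltr_distl => /andP[h1 h2].
    by rewrite /= in_itv/= ltrBlDr h2 -ltrBlDr h1.
  move=> y /= qy; apply: rA; apply: ltW.
  suff : ball x r y by rewrite -ball_normE.
  split => // i j; rewrite ord1 /ball/=.
  move: (qy j); rewrite /= in_itv/= -ltr_distl distrC => h.
  apply: (le_lt_trans (ler_distD (ratr (q ord0 j)) _ _)).
  by move: (qx j) h mr; move: (m.+1%:R^-1) => e; lra.
apply: countable_bigcupT_measurable => [|p]; first exact: countableP.
case: pselect => _ /=; last exact: measurable0.
exact: (@measurable_box (fun i => `](ratr (p.1 ord0 i) - p.2.+1%:R^-1),
  (ratr (p.1 ord0 i) + p.2.+1%:R^-1)[%classic) (fun i => measurable_itv _)).
Qed.

Lemma closed_measurable_rV (A : set V) : closed A -> measurable A.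
Proof. by move=> /closed_openC/open_measurable_rV/measurableC; rewrite setCK. Qed.

Lemma compact_closed_rV (K : set V) : compact K -> closed K.
Proof. by apply: compact_closed; exact: norm_hausdorff. Qed.

Lemma compact_measurable_rV (K : set V) : compact K -> measurable K.
Proof. by move=> /compact_closed_rV; exact: closed_measurable_rV. Qed.

Lemma continuous_measurable_rV f (D : set V) : continuous f -> measurable_fun D f.
Proof.
move=> cf; apply: measurable_funTS.
apply: (measurability _ (RGenOpens.measurableE R)).
move=> _ [_ [a [b ->] <-]]; rewrite setTI; apply: open_measurable_rV.
by move/continuousP : cf; apply; exact: interval_open.
Qed.

End borel_rV.

Section lebesgue_rV_finite.
Context {R : realType}.

Lemma measurable_cube n (M : R) :
  measurable [set x : 'rV[R]_n | forall i, `[- M, M]%classic (x ord0 i)].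
Proof.
exact: (@measurable_box R n (fun=> `[- M, M]%classic) (fun i => measurable_itv _)).
Qed.

(** The measure is defined by recursion on the dimension through products, and a cube is a product
    of an interval and a cube of one dimension less. *)
Lemma lebesgue_rV_cube_lty n (M : R) :
  (lebesgue_rV R n [set x : 'rV[R]_n | forall i, `[(- M)%R, M]%classic (x ord0 i)]
    < +oo)%E.
Proof.
elim: n => [|n IH].
  by rewrite /= diracE ltry.
set B : set 'rV[R]_n.+1 := [set x | _].
change (((lebesgue_measure \x (lebesgue_rV R n)) (@cons_rV R n @^-1` B) < +oo)%E).
pose B' := [set x : 'rV[R]_n | forall i, `[- M, M]%classic (x ord0 i)].
have mB' : measurable B' by exact: measurable_cube.
have -> : @cons_rV R n @^-1` B = `[- M, M]%classic `*` B'.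
  apply/seteqP; split => -[a v] /=.
    move=> h; split.
      have := h (@lshift 1 n ord0); rewrite [cons_rV _ _ _](@row_mxEl _ 1 1 n).
      by rewrite mxE.
    move=> i; have := h (@rshift 1 n i).
    by rewrite [cons_rV _ _ _](@row_mxEr _ 1 1 n).
  move=> [ha hv] i; have [j ->|j ->] := split_ordP (i : 'I_(1 + n)).
    by rewrite [cons_rV _ _ _](@row_mxEl _ 1 1 n) mxE.
  rewrite [cons_rV _ _ _](@row_mxEr _ 1 1 n); exact: hv.
rewrite product_measure1E//; apply: lte_mul_pinfty => //.
  have := @lebesgue_measure_itv R `[- M, M]; rewrite /= => ->.
  by case: ifP => // _; rewrite -EFinD.
Qed.

Lemma compact_finite_lebesgue_rV n (K : set 'rV[R]_n) : compact K ->
  (lebesgue_rV R n K < +oo)%E.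
Proof.
move=> cK; have [M [_ KM]] := compact_bounded cK.
have := lebesgue_rV_cube_lty n (M + 1); apply: le_lt_trans.
apply: le_measure; rewrite ?inE.
- exact: compact_measurable_rV.
- exact: measurable_cube.
move=> x Kx i /=; rewrite in_itv /= -ler_norml.
have xM : `|x| <= M + 1 by apply: KM => //; rewrite ltrDl.
apply: le_trans xM.
rewrite [leRHS]/Num.norm /= mx_normrE; apply/bigmax_geP; right => /=.
by exists (ord0, i).
Qed.

End lebesgue_rV_finite.

Section real_valued_integrable.
Context d (T : measurableType d) (R : realType).
Variables (mu : {measure set T -> \bar R}) (D : set T) (mD : measurable D).
Implicit Types f g : T -> R.

Lemma integrableD_EFin f g : mu.-integrable D (EFin \o f) ->
  mu.-integrable D (EFin \o g) -> mu.-integrable D (EFin \o (fun x => f x + g x)).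
Proof. exact: integrableD. Qed.

Lemma integrableZ_EFin f (c : R) : mu.-integrable D (EFin \o f) ->
  mu.-integrable D (EFin \o (fun x => c * f x)).
Proof. exact: integrableZl. Qed.

Lemma integrable_sum_EFin (I : Type) (s : seq I) (F : I -> T -> R) :
  (forall i, mu.-integrable D (EFin \o F i)) ->
  mu.-integrable D (EFin \o (fun x => \sum_(i <- s) F i x)).
Proof.
move=> iF; elim: s => [|i s IH].
  rewrite (_ : _ \o _ = cst 0%E); first exact: integrable0.
  by apply/funext => x /=; rewrite big_nil.
rewrite (_ : (fun _ => _) = fun x => F i x + \sum_(j <- s) F j x).
  exact: integrableD_EFin.
by apply/funext => x; rewrite big_cons.
Qed.

Lemma Rintegral_sum (I : Type) (s : seq I) (F : I -> T -> R) :
  (forall i, mu.-integrable D (EFin \o F i)) ->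
  \int[mu]_(x in D) (\sum_(i <- s) F i x) = \sum_(i <- s) \int[mu]_(x in D) F i x.
Proof.
move=> iF; elim: s => [|i s IH].
  rewrite big_nil (_ : (fun _ => _) = cst 0); last first.
    by apply/funext => x; rewrite big_nil.
  by rewrite /Rintegral integral0.
rewrite big_cons -IH -RintegralD//; last exact: integrable_sum_EFin.
by apply: eq_Rintegral => x _; rewrite big_cons.
Qed.

End real_valued_integrable.

Section integrability.
Context {R : realType} {n : nat}.
Local Notation V := 'rV[R]_n.
Local Notation mu := (lebesgue_rV R n).
Variables (Omega : set V) (Omega_open : open Omega).
Implicit Types (f g phi : V -> R) (K : set V).

Let mOmega : measurable Omega := open_measurable_rV Omega_open.

Lemma integrable_cst_compact K (c : R) : compact K ->
  mu.-integrable K (EFin \o cst c).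
Proof.
move=> cK; apply: measurable_bounded_integrable => //.
- exact: compact_measurable_rV.
- exact: compact_finite_lebesgue_rV.
- by exists `|c|; split; [exact: num_real|move=> x cx y _; exact: ltW].
Qed.

Lemma integrable_compact_supp K f g : compact K -> K `<=` Omega ->
  measurable_fun Omega f -> (forall x, ~ K x -> f x = 0) ->
  (forall x, K x -> `|f x| <= g x) -> mu.-integrable K (EFin \o g) ->
  mu.-integrable Omega (EFin \o f).
Proof.
move=> cK KO mf f0 fg ig; have mK := compact_measurable_rV cK.
have fE (A : set V) : K `<=` A -> (EFin \o f) \_ A = EFin \o f.
  move=> KA; apply/funext => x; rewrite patchE; case: ifPn => // xA.
  by rewrite /= f0// => /KA Ax; move/negP : xA; apply; rewrite inE.
apply/(integrable_mkcond _ mOmega); rewrite fE// -(fE K (fun x Kx => Kx)).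
apply/(integrable_mkcond _ mK); apply: le_integrable ig => //.
  by apply/measurable_EFinP; exact: measurable_funS mf.
move=> x Kx /=; rewrite lee_fin; apply: le_trans (fg x Kx) _.
exact: ler_norm.
Qed.

Lemma L2loc_integrable K f : L2loc Omega f -> compact K -> K `<=` Omega ->
  mu.-integrable K (EFin \o (fun x => f x ^+ 2)).
Proof.
move=> [mf fK] cK KO; have mK := compact_measurable_rV cK.
have mf2 : measurable_fun K (fun x => f x ^+ 2).
  by apply: measurable_funX; exact: measurable_funS mf.
apply/integrableP; split; first exact/measurable_EFinP.
have := fK K cK KO; congr (_ < _)%E; apply: eq_integral => x _ /=.
by rewrite normrX.
Qed.

(** The majorant is required only almost everywhere, because the limit field is controlled only off
    a null set. *)
Lemma L2locP f : measurable_fun Omega f ->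
  (forall K, compact K -> K `<=` Omega ->
     exists2 g, {ae mu, forall x, K x -> f x ^+ 2 <= g x} &
       mu.-integrable K (EFin \o g)) ->
  L2loc Omega f.
Proof.
move=> mf fK; split => // K cK KO; have mK := compact_measurable_rV cK.
have [g fg ig] := fK K cK KO.
have [_] := integrableP _ _ _ ig.
apply: le_lt_trans; apply: ae_ge0_le_integral => //.
- apply/measurable_EFinP; apply: measurable_funX; apply: measurableT_comp => //.
  exact: measurable_funS mf.
- by apply: measurableT_comp => //; have [] := integrableP _ _ _ ig.
- move: fg; apply: filterS => x fg Kx /=.
  rewrite lee_fin -normrX ger0_norm ?sqr_ge0//.
  exact: le_trans (fg Kx) (ler_norm _).
Qed.

Lemma continuous_bounded K f : compact K -> continuous f ->
  exists2 C : R, 0 <= C & forall x, K x -> `|f x| <= C.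
Proof.
move=> cK cf; have : compact (f @` K).
  by apply: continuous_compact => //; exact: continuous_subspaceT.
move=> /compact_bounded[M [_ MP]]; exists (`|M| + 1); first by rewrite addr_ge0.
move=> x Kx; apply: (MP (`|M| + 1)); last by exists x.
by rewrite ltr_pwDr// ler_norm.
Qed.

Lemma L2loc_continuous f : continuous f -> L2loc Omega f.
Proof.
move=> cf; apply: L2locP; first exact: continuous_measurable_rV.
move=> K cK KO; have [C C0 fC] := continuous_bounded cK cf.
exists (cst (C ^+ 2)); last exact: integrable_cst_compact.
by apply: aeW => x Kx; rewrite -real_normK ?num_real// ler_sqr ?nnegrE ?fC.
Qed.

(** The product of three factors serves both terms of the functional: [f = g] gives |Gamma|^2 phi,
    and [g = 1] gives Gamma . grad phi. It is dominated through |f g| <= f^2 + g^2. *)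
Lemma integrable_L2locMM f g phi K : L2loc Omega f -> L2loc Omega g ->
  continuous phi -> compact K -> K `<=` Omega -> (forall x, ~ K x -> phi x = 0) ->
  mu.-integrable Omega (EFin \o (fun x => f x * g x * phi x)).
Proof.
move=> f2 g2 cphi cK KO phi0; have mK := compact_measurable_rV cK.
have [C C0 phiC] := continuous_bounded cK cphi.
have [mf _] := f2; have [mg _] := g2.
apply: (@integrable_compact_supp K _ (fun x => C * (f x ^+ 2 + g x ^+ 2))) => //.
- apply: measurable_funM; first exact: measurable_funM.
  exact: continuous_measurable_rV.
- by move=> x /phi0 ->; rewrite mulr0.
- move=> x Kx; rewrite normrM mulrC ler_pM ?phiC// normrM.
  rewrite -[X in _ <= X + _]real_normK ?num_real//.
  rewrite -[X in _ <= _ + X]real_normK ?num_real//.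
  by move: (`|f x|) (`|g x|) (normr_ge0 (f x)) (normr_ge0 (g x)) => a b a0 b0; nra.
- apply: integrableZ_EFin => //; apply: integrableD_EFin => //.
    exact: L2loc_integrable.
  exact: L2loc_integrable.
Qed.

Lemma integrable_L2locM f phi K : L2loc Omega f ->
  continuous phi -> compact K -> K `<=` Omega -> (forall x, ~ K x -> phi x = 0) ->
  mu.-integrable Omega (EFin \o (fun x => f x * phi x)).
Proof.
move=> f2 cphi cK KO phi0.
rewrite (_ : (fun x => _) = fun x => f x * 1 * phi x); last first.
  by apply/funext => x; rewrite mulr1.
apply: (integrable_L2locMM f2 _ cphi cK) => //.
by apply: (@L2loc_continuous (cst 1)); exact: cst_continuous.
Qed.

End integrability.

(** * The Riccati functional *)

Section dot_product.
Context {R : realType} {n : nat}.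
Implicit Types u v : 'rV[R]_n.

Lemma dot_ge0 u : 0 <= dot u u.
Proof. by apply: sumr_ge0 => i _; rewrite -expr2 sqr_ge0. Qed.

Lemma dotC u v : dot u v = dot v u.
Proof. by apply: eq_bigr => i _; rewrite mulrC. Qed.

Lemma dotZl (a : R) u v : dot (a *: u) v = a * dot u v.
Proof. by rewrite /dot mulr_sumr; apply: eq_bigr => i _; rewrite mxE mulrA. Qed.

Lemma dot_lincomb (a b : R) u v :
  dot (a *: u + b *: v) (a *: u + b *: v) =
  a ^+ 2 * dot u u + 2 * a * b * dot u v + b ^+ 2 * dot v v.
Proof.
rewrite /dot !mulr_sumr -!big_split /=; apply: eq_bigr => i _.
by rewrite !mxE; ring.
Qed.

Lemma coord_sqr_le_dot u i : u ord0 i ^+ 2 <= dot u u.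
Proof.
rewrite /dot (bigD1 i)//= -expr2 lerDl; apply: sumr_ge0 => j _.
by rewrite -expr2 sqr_ge0.
Qed.

End dot_product.

Section riccati.
Context {R : realType} {n : nat}.
Local Notation V := 'rV[R]_n.
Local Notation mu := (lebesgue_rV R n).
Variables (Omega : set V) (Omega_open : open Omega) (sigma : schwartz_distr Omega).
Implicit Types (f g phi h : V -> R) (K : set V) (Gamma : V -> V).

Let mOmega : measurable Omega := open_measurable_rV Omega_open.

Definition continuous_field Gamma :=
  forall i, continuous (fun x => Gamma x ord0 i).

Definition riccati_integrand Gamma phi (x : V) : R :=
  dot (Gamma x) (grad phi x) + dot (Gamma x) (Gamma x) * phi x.

(* The distribution [sigma - div Gamma + |Gamma|^2], see [riccatiE]. *)
Definition riccati Gamma phi : R :=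
  sigma phi + \int[mu]_(x in Omega) riccati_integrand Gamma phi x.

Lemma L2loc_vec_continuous Gamma :
  continuous_field Gamma -> L2loc_vec Omega Gamma.
Proof. by move=> cG i; exact: L2loc_continuous. Qed.

Lemma integrable_dot_grad Gamma phi : L2loc_vec Omega Gamma ->
  test_function Omega phi ->
  mu.-integrable Omega (EFin \o (fun x => dot (Gamma x) (grad phi x))).
Proof.
move=> G2 [sphi cphi phiO]; apply: integrable_sum_EFin => // i.
rewrite (_ : (fun x => _) = fun x => Gamma x ord0 i * partial i phi x); last first.
  by apply/funext => x; rewrite mxE.
apply: (integrable_L2locM Omega_open (G2 i) _ cphi phiO).
  exact: smooth_continuous_partial.
by move=> x; exact: partial_supp.
Qed.

Lemma integrable_dot_mul Gamma phi K : L2loc_vec Omega Gamma ->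
  continuous phi -> compact K -> K `<=` Omega -> (forall x, ~ K x -> phi x = 0) ->
  mu.-integrable Omega (EFin \o (fun x => dot (Gamma x) (Gamma x) * phi x)).
Proof.
move=> G2 cphi cK KO phi0.
rewrite (_ : (fun x => _) =
  fun x => \sum_(i < n) Gamma x ord0 i * Gamma x ord0 i * phi x); last first.
  by apply/funext => x; rewrite mulr_suml.
apply: integrable_sum_EFin => // i.
exact: (integrable_L2locMM Omega_open (G2 i) (G2 i) cphi cK).
Qed.

Lemma integrable_dot_test Gamma phi : L2loc_vec Omega Gamma ->
  test_function Omega phi ->
  mu.-integrable Omega (EFin \o (fun x => dot (Gamma x) (Gamma x) * phi x)).
Proof.
move=> G2 [sphi cphi phiO].
apply: (integrable_dot_mul G2 (smooth_continuous sphi) cphi phiO).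
by move=> x; exact: supp_eq0.
Qed.

Lemma integrable_riccati Gamma phi : L2loc_vec Omega Gamma ->
  test_function Omega phi ->
  mu.-integrable Omega (EFin \o riccati_integrand Gamma phi).
Proof.
move=> G2 tphi; apply: integrableD_EFin => //.
  exact: integrable_dot_grad.
exact: integrable_dot_test.
Qed.

Lemma integrable_grad_sqr h : test_function Omega h ->
  mu.-integrable Omega (EFin \o (fun x => dot (grad h x) (grad h x))).
Proof.
move=> th; apply: integrable_dot_grad => //; apply: L2loc_vec_continuous => i.
rewrite (_ : (fun x => _) = partial i h); last by apply/funext => x; rewrite mxE.
by have [sh _ _] := th; exact: smooth_continuous_partial.
Qed.

Lemma riccatiE Gamma phi : L2loc_vec Omega Gamma -> test_function Omega phi ->
  riccati Gamma phi = sigma phi - (distr_div Omega Gamma phi -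
    distr_of_fun Omega (fun x => dot (Gamma x) (Gamma x)) phi).
Proof.
move=> G2 tphi; have [sphi cphi phiO] := tphi.
rewrite /riccati /riccati_integrand RintegralD//; last 2 first.
  exact: integrable_dot_grad.
  exact: integrable_dot_test.
congr (_ + _); rewrite opprB [LHS]addrC; congr (_ + _).
rewrite /distr_div /distr_partial /distr_of_fun -sumrN.
under [RHS]eq_bigr do rewrite opprK.
rewrite -Rintegral_sum// => [|i].
  by apply: eq_Rintegral => x _; apply: eq_bigr => i _; rewrite mxE.
apply: (integrable_L2locM Omega_open (G2 i) _ cphi phiO).
  exact: smooth_continuous_partial.
by move=> x; exact: partial_supp.
Qed.

Lemma form_bound_of_riccati Gamma h : L2loc_vec Omega Gamma ->
  test_function Omega h -> riccati Gamma (fun x => h x ^+ 2) <= 0 ->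
  sigma (fun x => h x ^+ 2) <=
    \int[mu]_(x in Omega) dot (grad h x) (grad h x).
Proof.
move=> G2 th; have [sh _ _] := th; rewrite /riccati -lerBrDr sub0r.
move=> /le_trans; apply; rewrite -[leRHS]opprK lerN2.
rewrite -mulN1r -RintegralZl//; last exact: integrable_grad_sqr.
apply: le_Rintegral => //.
- by apply: integrableZ_EFin => //; exact: integrable_grad_sqr.
- exact/integrable_riccati/test_function_sqr.
move=> x _; rewrite /riccati_integrand.
have -> : grad (fun x => h x ^+ 2) x = (2 * h x) *: grad h x.
  apply/rowP => i; rewrite !mxE.
  by rewrite (partialM i x sh sh); ring.
have := dot_ge0 (1 *: grad h x + h x *: Gamma x).
rewrite dot_lincomb [dot (Gamma x) (_ *: _)]dotC dotZl.
by move: (dot _ _) (dot _ _) (dot _ _) => a b c; nra.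
Qed.

Lemma continuous_mulr f g : continuous f -> continuous g ->
  continuous (fun x => f x * g x).
Proof. exact: (@CkM _ _ 0). Qed.

(** The witness is hidden behind its properties, here and in [smooth_sqrt_root], so that shift and
    root are atoms for [ring] and [field]. *)
Lemma smooth_shift_gt0 phi (d : R) : smooth phi -> (forall x, 0 <= phi x) -> 0 < d ->
  exists w, [/\ smooth w, forall x, w x = phi x + d, forall x, 0 < w x &
    forall i x, partial i w x = partial i phi x].
Proof.
move=> sphi phi0 d0; exists (fun x => phi x + d); split.
- exact: (smoothD sphi (smooth_cst d)).
- by [].
- by move=> x; rewrite ltr_wpDl.
- by move=> i x; rewrite (partialD i x sphi (smooth_cst d)) partial_cst addr0.
Qed.

Lemma smooth_sqrt_root f : smooth f -> (forall x, 0 < f x) ->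
  exists s, [/\ smooth s, forall x, 0 < s x, forall x, s x ^+ 2 = f x &
    forall i x, partial i s x = (2 * s x)^-1 * partial i f x].
Proof.
move=> sf f0; exists (fun x => Num.sqrt (f x)); split.
- exact: smooth_sqrt.
- by move=> x; rewrite sqrtr_gt0.
- by move=> x; rewrite sqr_sqrtr// ltW.
- by move=> i x; exact: partial_sqrt.
Qed.

(** The root of [phi] need not be smooth, whereas that of [w = phi + d] is, but lacks compact
    support; hence the trial function [s * psi], with [s] the root of [w] and [psi = 1] on the
    support of [phi]. Its square is [phi + d * psi ^+ 2] and its gradient has square
    [d * |grad psi|^2 + G]. So the form bound costs only [d * A] beyond the integral of [G], which
    the field [Gamma] gains back. *)
Lemma riccati_test_field phi (e : R) :
  (forall h, test_function Omega h ->
     sigma (fun x => h x ^+ 2) <=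
       \int[mu]_(x in Omega) dot (grad h x) (grad h x)) ->
  test_function Omega phi -> (forall x, 0 <= phi x) -> 0 < e ->
  exists2 Gamma, continuous_field Gamma &
    riccati Gamma phi <= e.
Proof.
move=> form_bound tphi phi0 e0; have [sphi cphi phiO] := tphi.
have [psi [tpsi psi0 psi1]] := smooth_urysohn Omega_open cphi phiO.
have [spsi _ _] := tpsi.
pose A := \int[mu]_(x in Omega) dot (grad psi x) (grad psi x)
          - sigma (fun x => psi x ^+ 2).
have [d d0 dA] : exists2 d : R, 0 < d & d * A <= e.
  have A1 : 0 < `|A| + 1 by rewrite ltr_wpDl.
  exists (e / (`|A| + 1)); first by rewrite divr_gt0.
  rewrite mulrAC ler_pdivrMr// ler_pM2l//.
  by rewrite (le_trans (ler_norm A))// lerDl.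
have [w [sw wE w0 pw]] := smooth_shift_gt0 sphi phi0 d0.
have [s [ss s0 s2 ps]] := smooth_sqrt_root sw w0.
have th : test_function Omega (fun x => s x * psi x) by exact: test_functionM.
have psiE x : phi x != 0 -> psi x = 1 by move=> /supp_neq0/psi1.
have dpsi i x : phi x != 0 -> partial i psi x = 0.
  move=> phix; rewrite /partial.
  have -> : 'D_(delta_mx ord0 i) psi x = 'D_(delta_mx ord0 i) (cst 1 : V -> R) x.
    apply: near_eq_derive.
    have nz : nbhs (phi x) [set t : R | t != 0].
      by apply: open_nbhs_nbhs; split => //; exact: open_neq.
    have : nbhs x (phi @^-1` [set t : R | t != 0]).
      exact: (smooth_continuous sphi nz).
    by apply: filterS => y; exact: psiE.
  exact: derive_cst.
have h2 : (fun x => (s x * psi x) ^+ 2) = fun x => d * psi x ^+ 2 + phi x.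
  apply/funext => x; rewrite exprMn s2 wE.
  have [->|phix] := eqVneq (phi x) 0; first by rewrite add0r addr0.
  by rewrite psiE// expr1n !mulr1 addrC.
pose G x := (4 * w x)^-1 * dot (grad phi x) (grad phi x).
have gradh x : dot (grad (fun x => s x * psi x) x) (grad (fun x => s x * psi x) x) =
    d * dot (grad psi x) (grad psi x) + G x.
  have gh i : grad (fun x => s x * psi x) x ord0 i = s x * partial i psi x +
      psi x * ((2 * s x)^-1 * partial i phi x).
    by rewrite mxE (partialM i x ss spsi) ps pw.
  rewrite /G /dot !mulr_sumr -big_split/=; apply: eq_bigr => i _.
  (* The two parts of the gradient never interact: [grad phi] vanishes where [phi = 0], and [psi] is
     locally constant elsewhere. *)
  rewrite !gh !mxE; have [phix|phix] := eqVneq (phi x) 0.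
    rewrite (partial_eq0 i sphi phi0 phix) !mulr0 !addr0.
    have -> : d = s x ^+ 2 by rewrite s2 wE phix add0r.
    by ring.
  rewrite dpsi// psiE// !mulr0 !add0r mul1r -s2.
  by field; rewrite gt_eqF.
have iG : mu.-integrable Omega (EFin \o G).
  have c4w : continuous (fun x => (4 * w x)^-1).
    apply: smooth_continuous; apply: smoothV.
      by move=> x; rewrite mulf_neq0// gt_eqF.
    exact: (smoothM (smooth_cst _) sw).
  rewrite (_ : G = fun x => dot (((4 * w x)^-1) *: grad phi x) (grad phi x)); last first.
    by apply/funext => x; rewrite dotZl.
  apply: integrable_dot_grad => //; apply: L2loc_vec_continuous => i.
  rewrite (_ : (fun x => _) = (fun x => (4 * w x)^-1 * partial i phi x)); last first.
    by apply/funext => x; rewrite !mxE.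
  exact: (continuous_mulr c4w (smooth_continuous_partial sphi)).
have sigma_le : sigma phi <= d * A + \int[mu]_(x in Omega) G x.
  have := form_bound _ th.
  rewrite h2 (schwartz_linear sigma d (test_function_sqr tpsi) tphi).
  under eq_Rintegral do rewrite gradh.
  rewrite RintegralD//; last first.
    by apply: integrableZ_EFin => //; exact: integrable_grad_sqr.
  rewrite RintegralZl//; last exact: integrable_grad_sqr.
  rewrite /A mulrBr.
  by move: (\int[mu]_(_ in _) _) (\int[mu]_(_ in _) _) (sigma _) (sigma _) => *; lra.
pose Gamma x := ((- 2) * w x)^-1 *: grad phi x.
have cGamma i : continuous (fun x => Gamma x ord0 i).
  rewrite (_ : (fun x => _) = (fun x => ((- 2) * w x)^-1 * partial i phi x)); last first.
    by apply/funext => x; rewrite !mxE.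
  have c2w : continuous (fun x => ((- 2) * w x)^-1).
    apply: smooth_continuous; apply: smoothV.
      by move=> x; rewrite mulf_neq0 ?oppr_eq0// gt_eqF.
    exact: (smoothM (smooth_cst _) sw).
  exact: (continuous_mulr c2w (smooth_continuous_partial sphi)).
exists Gamma => //.
rewrite /riccati; apply: le_trans dA.
have : \int[mu]_(x in Omega) riccati_integrand Gamma phi x <=
    \int[mu]_(x in Omega) (- 1 * G x).
  apply: le_Rintegral => //.
  - by apply: integrable_riccati => //; exact: L2loc_vec_continuous.
  - exact: integrableZ_EFin.
  move=> x _; rewrite /riccati_integrand /Gamma /G dotZl.
  have -> (a : R) u : dot (a *: u) (a *: u) = a ^+ 2 * dot u u :> R.
    by rewrite /dot mulr_sumr; apply: eq_bigr => i _; rewrite !mxE; ring.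
  set D := dot _ _; have D0 : 0 <= D by exact: dot_ge0.
  have phiw : phi x <= w x by rewrite wE lerDl ltW.
  have -> : ((- 2) * w x)^-1 * D + (((- 2) * w x)^-1) ^+ 2 * D * phi x =
    - 1 * ((4 * w x)^-1 * D) - D * (4 * w x ^+ 2)^-1 * (w x - phi x).
    by field; rewrite gt_eqF.
  rewrite lerBlDr lerDl mulr_ge0 ?subr_ge0// mulr_ge0// invr_ge0.
  by rewrite mulr_ge0// sqr_ge0.
rewrite RintegralZl// mulN1r.
by move: sigma_le; move: (\int[mu]_(_ in _) _) (\int[mu]_(_ in _) _) => *; lra.
Qed.

End riccati.

(** * Convex minimization *)

Section convex_alternative.
Context {R : realType} {m : nat}.
Local Notation V := 'rV[R]_m.

Lemma continuous_dot_sqr : continuous (fun v : V => dot v v).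
Proof.
apply: smooth_continuous; apply: smooth_sum => i.
by apply: smoothM; exact: smooth_coord.
Qed.

(** [p] is the point of the closure nearest to the origin in the Euclidean sense; it exists because
    the part of the closure no farther than [v0] is compact. If [dot p v < dot p p], moving from [p]
    towards [v] would decrease the length. *)
Lemma closest_point (A : set V) : A !=set0 ->
  (forall u v (t : R), A u -> A v -> 0 <= t <= 1 -> A ((1 - t) *: u + t *: v)) ->
  exists2 p, closure A p & forall v, A v -> dot p p <= dot p v.
Proof.
move=> [v0 Av0] convA.
pose B := closure A `&` [set v : V | dot v v <= dot v0 v0].
have cB : closed B.
  apply: closedI; first exact: closed_closure.
  apply: (@preimage_closed _ _ (fun v : V => dot v v) [set r | r <= dot v0 v0]).
    by move=> v _; exact: continuous_dot_sqr.
  exact: closed_le.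
have compB : compact B.
  have cube : compact [set v : V |
      forall i, v ord0 i \in `[- (1 + dot v0 v0), 1 + dot v0 v0]].
    apply: (@rV_compact _ _ (fun=> `[- (1 + dot v0 v0), 1 + dot v0 v0]%classic)).
    by move=> _; exact: segment_compact.
  apply: subclosed_compact cB cube _.
  move=> v [_ /= vv0] i /=; rewrite in_itv/= -ler_norml.
  have := le_trans (coord_sqr_le_dot v i) vv0.
  rewrite -real_normK ?num_real//.
  by move: (`|v ord0 i|) (normr_ge0 (v ord0 i)) (dot v0 v0) => r r0 D; nra.
have B0 : B !=set0 by exists v0; split; [exact: subset_closure|exact: lexx].
have [p pB pmin] : exists2 p, p \in B & forall v, v \in B -> dot p p <= dot v v.
  apply: (@compact_EVT_min _ R (fun v : V => dot v v)) => //.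
  by apply: continuous_subspaceT; exact: continuous_dot_sqr.
move: pB; rewrite inE => -[pA pv0]; exists p => //.
have {}pmin v : closure A v -> dot p p <= dot v v.
  move=> Av; have [vv0|/ltW] := leP (dot v v) (dot v0 v0); last exact: le_trans.
  by apply: pmin; rewrite inE.
move=> v Av.
have seg (t : R) : 0 <= t <= 1 ->
    dot p p <= dot ((1 - t) *: p + t *: v) ((1 - t) *: p + t *: v).
  move=> t01; apply: pmin.
  have : closed [set u | closure A ((1 - t) *: u + t *: v)].
    apply: (@preimage_closed _ _ (fun u : V => (1 - t) *: u + t *: v) (closure A)).
      move=> u _.
      apply: (@continuousD _ _ _ (fun u : V => (1 - t) *: u) (cst (t *: v))).
        exact: scaler_continuous.
      exact: cst_continuous.
    exact: closed_closure.
  move=> /closure_id cl; move: pA.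
  have sub : A `<=` [set u | closure A ((1 - t) *: u + t *: v)].
    by move=> u Au; apply: subset_closure; exact: convA.
  by move=> /(closureS sub); rewrite -cl.
rewrite leNgt; apply/negP => pv.
(* With [q = |p - v|^2] and [r = dot p p - dot p v], the square length at parameter [t] is
   [dot p p - 2 * t * r + t ^+ 2 * q]. The [t] below lies in ]0, 1] and has [t * q < r], so this is
   less than [dot p p]. *)
pose q := dot p p - 2 * dot p v + dot v v.
have q0 : 0 <= q.
  have := dot_ge0 (1 *: p + (- 1) *: v); rewrite dot_lincomb /q.
  by move: (dot _ _) (dot _ _) (dot _ _) => a b c; lra.
pose r := dot p p - dot p v.
have r0 : 0 < r by rewrite subr_gt0.
pose t := r / (r + q + 1).
have den0 : 0 < r + q + 1 by rewrite addr_gt0// ltr_wpDr.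
have t0 : 0 < t by rewrite divr_gt0.
have t1 : t <= 1 by rewrite ler_pdivrMr// mul1r -addrA lerDl addr_ge0.
have tq : t * q < r.
  rewrite /t mulrAC ltr_pdivrMr// ltr_pM2l//.
  by rewrite ltr_pwDr// lerDr ltW.
have := seg t; rewrite (ltW t0) t1 => /(_ isT); rewrite dot_lincomb.
move: tq (mulr_gt0 t0 r0); rewrite /q /r.
move: (dot p p) (dot p v) (dot v v) t0 => a b c t0 tq tr.
apply/negP; rewrite -ltNge.
have : t * (t * (a - 2 * b + c)) < t * (a - b) by rewrite ltr_pM2l.
nra.
Qed.

(** Separation in finite dimension. The set [A] of vectors dominating some value of [F] is convex
    and closed upwards, which makes its point [p] nearest to the origin nonnegative. The coordinates
    of [p] are then admissible weights, and the hypothesis for them, with half of [dot p p] as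
    tolerance, contradicts minimality unless [p = 0]. So the origin is in the closure of [A]. *)
Lemma convex_alternative (X : lmodType R) (E : set X) (F : 'I_m -> X -> R) :
  E !=set0 ->
  (forall x y (t : R), E x -> E y -> 0 <= t <= 1 -> E ((1 - t) *: x + t *: y)) ->
  (forall i x y (t : R), E x -> E y -> 0 <= t <= 1 ->
     F i ((1 - t) *: x + t *: y) <= (1 - t) * F i x + t * F i y) ->
  (forall (l : 'I_m -> R) (e : R), (forall i, 0 <= l i) -> 0 < e ->
     exists2 x, E x & \sum_(i < m) l i * F i x <= e) ->
  forall e : R, 0 < e -> exists2 x, E x & forall i, F i x <= e.
Proof.
move=> [x0 Ex0] convE convF FE e e0.
pose A : set V := [set v | exists2 x, E x & forall i, F i x <= v ord0 i].
have FA x : E x -> A (\row_i F i x) by move=> Ex; exists x => // i; rewrite mxE.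
have [||p pA pmin] := @closest_point A.
- by exists (\row_i F i x0); exact: FA.
- move=> u v t [x Ex xu] [y Ey yv] t01; exists ((1 - t) *: x + t *: y).
    exact: convE.
  move=> i; apply: (le_trans (convF i x y t Ex Ey t01)).
  move/andP : t01 => [t0 t1].
  by rewrite !mxE lerD// ler_wpM2l// subr_ge0.
have p0 i : 0 <= p ord0 i.
  rewrite leNgt; apply/negP => pi0.
  pose v0 : V := \row_i F i x0.
  (* The length of the upward move along coordinate [i] that brings the product with [p] to exactly
     -1. *)
  pose s := (dot p v0 + 1) / (- p ord0 i).
  have pv0 : 0 <= dot p v0 by apply: le_trans (pmin _ (FA _ Ex0)); exact: dot_ge0.
  have s0 : 0 <= s by rewrite divr_ge0 ?addr_ge0// oppr_ge0 ltW.
  have /pmin : A (v0 + s *: delta_mx ord0 i).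
    by exists x0 => // j; rewrite !mxE lerDl mulr_ge0.
  have -> : dot p (v0 + s *: delta_mx ord0 i) = -1.
    have -> : dot p (v0 + s *: delta_mx ord0 i) = dot p v0 + s * p ord0 i.
      rewrite /dot; under eq_bigr do rewrite mxE mulrDr.
      rewrite big_split/=; congr (_ + _).
      rewrite (bigD1 i)//= big1 ?addr0; last first.
        by move=> j ji; rewrite !mxE (negbTE ji) andbF !mulr0.
      by rewrite !mxE !eqxx mulr1 mulrC.
    by rewrite /s invrN mulrN mulNr divfK ?lt_eqF// opprD addrA subrr sub0r.
  by move=> /(le_trans (dot_ge0 _)); rewrite lerNr oppr0 ler10.
have pp0 : dot p p = 0.
  apply/eqP; rewrite eq_le dot_ge0 andbT leNgt; apply/negP => pp.
  have [x Ex] := FE (fun i => p ord0 i) (dot p p / 2) p0 (divr_gt0 pp (ltr0Sn _ 1)).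
  have := pmin _ (FA _ Ex).
  have -> : dot p (\row_i F i x) = \sum_(i < m) p ord0 i * F i x.
    by apply: eq_bigr => i _; rewrite mxE.
  by move: pp; move: (dot p p) => a; lra.
have pE : p = 0.
  apply/rowP => i; rewrite mxE; apply/eqP; rewrite -sqrf_eq0 eq_le sqr_ge0 andbT.
  by rewrite -pp0 coord_sqr_le_dot.
have /pA[v [[x Ex xv] pv]] : nbhs p (ball p e) by exact: nbhsx_ballx.
exists x => // i; apply: (le_trans (xv i)).
have [_ /(_ ord0 i)] := pv; rewrite pE mxE /ball/= sub0r normrN => /ltW.
exact: le_trans (ler_norm _).
Qed.

End convex_alternative.

Section directed_minimizers.
Context {R : realType} {X : lmodType R} {I : Type}.
Variables (leI : I -> I -> Prop) (join : I -> I -> I).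
Variables (C : I -> set X) (Q : I -> X -> R).
Hypothesis le_tr : forall i j k, leI i j -> leI j k -> leI i k.
Hypothesis le_joinl : forall i j, leI i (join i j).
Hypothesis le_joinr : forall i j, leI j (join i j).
Hypothesis C_le : forall i j, leI i j -> C j `<=` C i.
(** The laws of [Q] are asked only on the constraint sets: [Q] will be an integral, and their fields
    are continuous, hence have integrable integrands. *)
Hypothesis Q_le : forall i j x, leI i j -> C j x -> Q i x <= Q j x.
Hypothesis Q_ge0 : forall i x, 0 <= Q i x.
Hypothesis C_mid : forall i x y, C i x -> C i y -> C i (2^-1 *: (x + y)).
Hypothesis Q_parallelogram : forall i x y, C i x -> C i y ->
  Q i (x - y) = 2 * Q i x + 2 * Q i y - 4 * Q i (2^-1 *: (x + y)).
Variable M : R.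
Hypothesis Q_bound : forall i, exists2 x, C i x & Q i x <= M.

Let D i := inf (Q i @` C i).

Let has_inf_D i : has_inf (Q i @` C i).
Proof.
split; first by have [x Cx _] := Q_bound i; exists (Q i x), x.
by exists 0 => _ [x _ <-].
Qed.

Let D_le i x : C i x -> D i <= Q i x.
Proof. by move=> Cx; apply: ge_inf; [case: (has_inf_D i)|exists x]. Qed.

Let D_mono i j : leI i j -> D i <= D j.
Proof.
move=> ij; apply: lb_le_inf; first by case: (has_inf_D j).
move=> _ [x Cx <-]; apply: le_trans (Q_le ij Cx).
by apply: D_le; exact: C_le Cx.
Qed.

(* Near-minimizers of [Q i] over [C i] with [i] large form a Cauchy net, by the
   parallelogram law. *)
Lemma directed_minimizers (eta : nat -> R) (e : nat -> I) :
  (forall k, 0 < eta k) -> (forall k, eta k.+1 <= eta k) ->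
  exists (a : nat -> I) (x : nat -> X),
    [/\ forall k, leI (e k) (a k), forall k, C (a k) (x k),
        forall k, Q (a k) (x k - x k.+1) <= eta k &
        forall i, exists y : nat -> X, forall k,
          C (join (a k) i) (y k) /\ Q (a k) (x k - y k) <= eta k].
Proof.
move=> eta0 eta_le.
have hsD : has_sup (range D).
  split; first by exists (D (e 0%N)), (e 0%N).
  exists M => _ [i _ <-]; have [x Cx xM] := Q_bound i.
  by apply: le_trans xM; exact: D_le.
pose d := sup (range D).
(* In the parallelogram law two values are at most [d + del k] and the midpoint has at least
   [d - del k], so the difference has at most [4 * (d + del k) - 4 * (d - del k) = 8 * del k]. *)
pose del k := eta k / 8.
have del0 k : 0 < del k by rewrite divr_gt0.
have bex k : exists b, d - del k <= D b.
  have [_ [b _ <-] db] := sup_adherent (del0 k) hsD.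
  by exists b; exact: ltW.
pose b k := projT1 (cid (bex k)).
have bP k : d - del k <= D (b k) by rewrite /b; case: cid.
(* An increasing sequence that dominates both the prescribed [e k] and an index whose infimum is
   within [del k] of the supremum [d]. *)
pose a := fix a k := if k is k'.+1 then join (a k') (join (e k) (b k))
                     else join (e 0%N) (b 0%N).
have ea k : leI (e k) (a k).
  by case: k => [|k] /=; [exact: le_joinl|exact: le_tr (le_joinl _ _) (le_joinr _ _)].
have ba k : leI (b k) (a k).
  by case: k => [|k] /=; [exact: le_joinr|exact: le_tr (le_joinr _ _) (le_joinr _ _)].
have zex k i : exists z, C i z /\ Q i z <= d + del k.
  have [_ [z Cz <-] zD] := inf_adherent (del0 k) (has_inf_D i).
  exists z; split => //; apply: (le_trans (ltW zD)); rewrite lerD2r.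
  by apply: ub_le_sup; [case: hsD|exists i].
have close k z z' : C (a k) z -> C (a k) z' -> Q (a k) z <= d + del k ->
    Q (a k) z' <= d + del k -> Q (a k) (z - z') <= eta k.
  move=> Cz Cz' Qz Qz'; rewrite Q_parallelogram//.
  have := D_le (C_mid Cz Cz'); have := D_mono (ba k); have := bP k.
  rewrite (_ : eta k = 8 * del k); last by rewrite /del; field.
  move: (Q _ (_ *: _)) (D _) (D _) => q D1 D2; lra.
pose x k := projT1 (cid (zex k (a k))).
have [xC xQ] : (forall k, C (a k) (x k)) /\ (forall k, Q (a k) (x k) <= d + del k).
  by split => k; rewrite /x; case: cid => ? [].
exists a, x; split => // [k|i].
  have aa : leI (a k) (a k.+1) by exact: le_joinl.
  apply: close => //; first exact: C_le aa _ _.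
  apply: (le_trans (Q_le aa (xC _))); apply: (le_trans (xQ _)).
  by rewrite lerD2l ler_pM2r ?invr_gt0.
(* [y k] near-minimizes under the extra constraint [i]. Its value is still at most [d + del k], as
   [d] bounds the infima of all indices, so it is as close to [x k] as any other near-minimizer. *)
exists (fun k => projT1 (cid (zex k (join (a k) i)))) => k.
case: cid => y /= [Cy Qy]; split => //.
have aj := le_joinl (a k) i.
apply: close => //; first exact: C_le aj _ Cy.
exact: le_trans (Q_le aj Cy) Qy.
Qed.

End directed_minimizers.

(** * Fast L^2_loc sequences *)

Section geometric_sequences.
Context {R : realType}.

Lemma sum_half_le (N : nat) : \sum_(k < N) 2^-1 ^+ k <= 2 :> R.
Proof.
suff -> : \sum_(k < N) 2^-1 ^+ k = 2 - 2 * 2^-1 ^+ N :> R.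
  by rewrite lerBlDr lerDl mulr_ge0// exprn_ge0// invr_ge0.
elim: N => [|N IH]; first by rewrite big_ord0 expr0 mulr1 subrr.
by rewrite big_ord_recr /= IH exprS; field.
Qed.

Lemma geometric_cauchy (s : nat -> R) (A : R) :
  (forall k, `|s k - s k.+1| <= A * 2^-1 ^+ k) ->
  exists l : R, s k @[k --> \oo] --> l.
Proof.
move=> sA.
have : cvgn (series (telescope s)).
  apply: normed_cvg; apply: (@series_le_cvg _ _ (geometric A 2^-1)).
  - by move=> k; exact: normr_ge0.
  - by move=> k; exact: le_trans (sA k).
  - by move=> k; rewrite /= /telescope distrC; exact: sA.
  - by apply: is_cvg_geometric_series; rewrite ger0_norm; lra.
rewrite telescopeK => /cvg_ex[l sl]; exists (l + s 0%N).
have : (s k - s 0%N) + s 0%N @[k --> \oo] --> l + s 0%N.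
  by apply: cvgD; [exact: sl|exact: cvg_cst].
by under eq_fun do rewrite subrK.
Qed.

Lemma geometric_bound (s : nat -> R) (A : R) :
  (forall k, `|s k - s k.+1| <= A * 2^-1 ^+ k) ->
  forall k, `|s k - s 0%N| <= 2 * A.
Proof.
move=> sA k; have A0 : 0 <= A.
  by have := le_trans (normr_ge0 _) (sA 0%N); rewrite expr0 mulr1.
suff : `|s k - s 0%N| <= \sum_(j < k) A * 2^-1 ^+ j.
  move=> /le_trans; apply; rewrite -mulr_sumr mulrC ler_wpM2r//.
  exact: sum_half_le.
elim: k => [|k IH]; first by rewrite subrr normr0 big_ord0.
rewrite big_ord_recr /= addrC; apply: le_trans (lerD (sA k) IH).
rewrite -[in leRHS](normrN (s k - s k.+1)) opprB.
by rewrite (_ : _ - _ = (s k.+1 - s k) + (s k - s 0%N)) ?ler_normD//; ring.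
Qed.

(** The origin of the rate 16: of a mean square decay like 16^-k, a factor 4^k is spent on the
    dominating series, and its square root is the pointwise rate 2^-k, which is summable. *)
Lemma sqr_le_geometric (d g : R) k : 0 <= g -> 4 ^+ k * d ^+ 2 <= g ->
  `|d| <= Num.sqrt g * 2^-1 ^+ k.
Proof.
move=> g0 dg; rewrite -ler_sqr ?nnegrE ?mulr_ge0 ?sqrtr_ge0 ?exprn_ge0//.
rewrite real_normK ?num_real// exprMn sqr_sqrtr// -exprM mulnC exprM.
rewrite (_ : 2^-1 ^+ 2 = 4^-1); last by field.
by rewrite exprVn ler_pdivlMr ?exprn_gt0// mulrC.
Qed.

End geometric_sequences.

Section fast_L2_sequences.
Context {R : realType} {n : nat}.
Local Notation V := 'rV[R]_n.
Local Notation mu := (lebesgue_rV R n).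
Variables (Omega : set V) (Omega_open : open Omega).

Let mOmega : measurable Omega := open_measurable_rV Omega_open.

Lemma integrable_sqr_compact K (u : V -> R) : compact K -> continuous u ->
  mu.-integrable K (EFin \o (fun x => u x ^+ 2)).
Proof.
move=> cK cu; have [C C0 uC] := continuous_bounded cK cu.
have mK := compact_measurable_rV cK.
apply: le_integrable (integrable_cst_compact (C ^+ 2) cK) => //.
  by apply/measurable_EFinP; apply: measurable_funX; exact: continuous_measurable_rV.
move=> x Kx /=; rewrite lee_fin !normrX ler_sqr ?nnegrE//.
exact: le_trans (uC x Kx) (ler_norm _).
Qed.

(* The dominating function is [g = sum_k 4^k (u k)^2], which is integrable by
   monotone convergence. *)
Lemma fast_L2_dominated (u : nat -> V -> R) :
  (forall k, continuous (u k)) ->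
  (forall K, compact K -> K `<=` Omega ->
     exists C : R, forall k, \int[mu]_(x in K) (u k x ^+ 2) <= C * 16^-1 ^+ k) ->
  exists g : V -> R, [/\ measurable_fun setT g, forall x, 0 <= g x,
    forall K, compact K -> K `<=` Omega -> mu.-integrable K (EFin \o g) &
    {ae mu, forall x, Omega x -> forall k, 4 ^+ k * u k x ^+ 2 <= g x}].
Proof.
move=> cu uK.
pose f k x : \bar R := (4 ^+ k * u k x ^+ 2)%:E.
have f0 k x : (0 <= f k x)%E by rewrite lee_fin mulr_ge0 ?sqr_ge0// exprn_ge0.
have mf k D : measurable_fun D (f k).
  apply/measurable_EFinP; apply: measurable_funM => //.
  by apply: measurable_funX; exact: continuous_measurable_rV.
pose T x : \bar R := (\sum_(k <oo) f k x)%E.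
have T0 x : (0 <= T x)%E by apply: nneseries_ge0 => k _ _; exact: f0.
have mT D : measurable_fun D T.
  by apply: ge0_emeasurable_sum => // k _; exact: mf.
have iT K : compact K -> K `<=` Omega -> mu.-integrable K T.
  move=> cK KO; have mK := compact_measurable_rV cK; have [C uC] := uK K cK KO.
  have C0 : 0 <= C.
    have := uC 0%N; rewrite expr0 mulr1; apply: le_trans.
    by apply: Rintegral_ge0 => x _; exact: sqr_ge0.
  apply/integrableP; split => //.
  under eq_integral do rewrite gee0_abs//.
  rewrite integral_nneseries//.
  apply: (@le_lt_trans _ _ (2 * C)%:E); last exact: ltry.
  apply: lime_le.
    by apply: is_cvg_nneseries => k _ _; apply: integral_ge0 => x _; exact: f0.
  apply: nearW => N.
  rewrite big_mkord.
  (* After the weight 4^k, a decay 4^-k is left; 2^-k is a sufficient bound for it. *)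
  apply: (@le_trans _ _ (\sum_(k < N) (C * 2^-1 ^+ k)%:E)%E).
    apply: lee_sum => k _.
    have iu := integrable_sqr_compact cK (cu k).
    have -> : (\int[mu]_(x in K) f k x = (4 ^+ k * \int[mu]_(x in K) (u k x ^+ 2))%:E)%E.
      rewrite -RintegralZl// fineK//; apply: integrable_fin_num => //.
      exact: integrableZ_EFin.
    rewrite lee_fin.
    have k4 : 0 <= 4 ^+ k :> R by exact: exprn_ge0.
    apply: (le_trans (ler_wpM2l k4 (uC k))).
    rewrite mulrCA ler_wpM2l// -exprMn.
    by rewrite lerXn2r ?nnegrE//; lra.
  by rewrite sumEFin lee_fin -mulr_sumr mulrC ler_wpM2r// sum_half_le.
(* [fine] sends an infinite sum to 0. This keeps the function below [T], hence integrable, and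
   spoils the pointwise bound only on a null set. *)
have mg : measurable_fun setT (fine \o T).
  by apply: measurableT_comp => //; exact: mT.
exists (fine \o T); split => //.
- by move=> x; exact: fine_ge0.
- move=> K cK KO; have mK := compact_measurable_rV cK.
  apply: le_integrable (iT K cK KO) => //.
    by apply/measurable_EFinP; exact: measurable_funTS.
  move=> x _ /=; have := T0 x; case: (T x) => [r| |]//= _.
  by rewrite normr0 leey.
(* Integrability is known on compact subsets only; countably many of them cover [Omega], and so one
   null set suffices. *)
- have aeK j : {ae mu, forall x, exhaust Omega j x -> T x \is a fin_num}.
    apply: integrable_ae.
      exact: (compact_measurable_rV (@exhaust_compact _ _ Omega j)).
    by apply: iT; [exact: exhaust_compact|exact: exhaust_sub].
  have := ae_foralln aeK; apply: filterS => x Tx Ox k.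
  have [j jx] := exhaust_ge Omega_open (@compact_set1 _ x)
    (fun y (yx : [set x] y) => eq_ind_r Omega Ox yx).
  have Tfin := Tx j (jx j (leqnn j) x erefl).
  rewrite -lee_fin /= fineK//.
  apply: le_trans (@nneseries_lim_ge _ (f ^~ x) predT 0 k.+1 (fun k _ _ => f0 k x)).
  rewrite big_mkord big_ord_recr/= leeDr// sume_ge0//.
Qed.

(* The a.e. limit of a fast Cauchy sequence is taken as [limn_esup] to be
   measurable without discarding a null set. *)
Lemma fast_L2_limit (u : nat -> V -> R) :
  (forall k, continuous (u k)) ->
  (forall K, compact K -> K `<=` Omega ->
     exists C : R, forall k,
       \int[mu]_(x in K) ((u k x - u k.+1 x) ^+ 2) <= C * 16^-1 ^+ k) ->
  exists l H : V -> R, [/\ measurable_fun setT l,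
    forall K, compact K -> K `<=` Omega -> mu.-integrable K (EFin \o H),
    {ae mu, forall x, Omega x -> u k x @[k --> \oo] --> l x} &
    {ae mu, forall x, Omega x -> forall k, u k x ^+ 2 <= H x}].
Proof.
move=> cu uK.
have cd k : continuous (fun x => u k x - u k.+1 x).
  by move=> x; exact: (continuousB (cu k x) (cu k.+1 x)).
have [g [mg g0 ig gae]] := fast_L2_dominated cd uK.
exists (fun x => fine (limn_esup (fun k => (u k x)%:E))).
(* From [|u k - u 0| <= 2 * sqrt g] and a^2 <= 2 b^2 + 2 (a - b)^2. *)
exists (fun x => 2 * u 0%N x ^+ 2 + 8 * g x).
have geo x k : 4 ^+ k * (u k x - u k.+1 x) ^+ 2 <= g x ->
    `|u k x - u k.+1 x| <= Num.sqrt (g x) * 2^-1 ^+ k.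
  exact: sqr_le_geometric.
split.
- apply: measurableT_comp => //; apply: measurable_fun_limn_esup => k.
  by apply/measurable_EFinP; exact: continuous_measurable_rV.
- move=> K cK KO; have mK := compact_measurable_rV cK.
  apply: integrableD_EFin => //; apply: integrableZ_EFin => //.
    exact: integrable_sqr_compact.
  exact: ig.
- move: gae; apply: filterS => x gx Ox.
  have [l ul] := geometric_cauchy (fun k => geo x k (gx Ox k)).
  suff -> : fine (limn_esup (fun k => (u k x)%:E)) = l by [].
  have eul : (u k x)%:E @[k --> \oo] --> l%:E.
    by apply/fine_cvgP; split => //; exact: nearW.
  by rewrite (cvg_limn_einf_sup eul).
- move: gae; apply: filterS => x gx Ox k.
  have := geometric_bound (fun k => geo x k (gx Ox k)) k.
  have := sqr_sqrtr (g0 x); have := sqrtr_ge0 (g x).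
  move: (g x) (u k x) (u 0%N x) (Num.sqrt _) => c a b r r0 <- ab.
  have : `|a - b| ^+ 2 <= (2 * r) ^+ 2 by rewrite ler_sqr ?nnegrE// mulr_ge0.
  by rewrite real_normK ?num_real//; have := sqr_ge0 (a - 2 * b); nra.
Qed.

(** Transfers limit and domination to a second sequence at fast vanishing distance. It is meant for
    the near-minimizers [v] that obey one more constraint than [u]. *)
Lemma fast_L2_null (u v : nat -> V -> R) (l H : V -> R) :
  (forall k, continuous (u k)) -> (forall k, continuous (v k)) ->
  (forall K, compact K -> K `<=` Omega -> mu.-integrable K (EFin \o H)) ->
  {ae mu, forall x, Omega x -> u k x @[k --> \oo] --> l x} ->
  {ae mu, forall x, Omega x -> forall k, u k x ^+ 2 <= H x} ->
  (forall K, compact K -> K `<=` Omega ->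
     exists C : R, forall k,
       \int[mu]_(x in K) ((u k x - v k x) ^+ 2) <= C * 16^-1 ^+ k) ->
  exists H' : V -> R, [/\
    forall K, compact K -> K `<=` Omega -> mu.-integrable K (EFin \o H'),
    {ae mu, forall x, Omega x -> v k x @[k --> \oo] --> l x} &
    {ae mu, forall x, Omega x -> forall k, v k x ^+ 2 <= H' x}].
Proof.
move=> cu cv iH ul uH uvK.
have cd k : continuous (fun x => u k x - v k x).
  by move=> x; exact: (continuousB (cu k x) (cv k x)).
have [g [mg g0 ig gae]] := fast_L2_dominated cd uvK.
exists (fun x => 2 * H x + 2 * g x); split.
- move=> K cK KO; have mK := compact_measurable_rV cK.
  by apply: integrableD_EFin => //; apply: integrableZ_EFin => //; [exact: iH|exact: ig].
- apply: filterS2 ul gae => x ulx gx Ox.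
  have -> : v^~ x = (fun k => u k x - (u k x - v k x)).
    by apply/funext => k; rewrite opprB addrC subrK.
  rewrite -[X in _ --> X]subr0; apply: cvgB; first exact: ulx.
  apply/cvgr0Pnorm_le => e e0.
  have := @cvg_geometric R (Num.sqrt (g x)) 2^-1.
  rewrite ger0_norm ?invr_ge0// invf_lt1// ltr1n => /(_ isT)/cvgr0Pnorm_le/(_ e e0).
  apply: filterS => k; apply: le_trans.
  apply: le_trans (ler_norm _).
  by apply: sqr_le_geometric => //; exact: gx.
- apply: filterS2 uH gae => x uHx gx Ox k.
  have := uHx Ox k; have := gx Ox k.
  have : 1 <= 4 ^+ k :> R by rewrite exprn_ege1// ler1n.
  have := sqr_ge0 (u k x - v k x); move: (4 ^+ k) => q.
  have := sqr_ge0 (2 * u k x - v k x).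
  move: (u k x) (v k x) (H x) (g x) => a b c d h1 h2 h3 h4 h5.
  have : (a - b) ^+ 2 <= d by apply: le_trans h4; rewrite ler_peMl.
  by nra.
Qed.

End fast_L2_sequences.

(** * Linearity, convexity, coercivity and continuity of the Riccati functional *)

Lemma cvg_seq_sum (R : realType) (I : Type) (s : seq I) (F : I -> nat -> R)
    (l : I -> R) : (forall i, F i k @[k --> \oo] --> l i) ->
  \sum_(i <- s) F i k @[k --> \oo] --> \sum_(i <- s) l i.
Proof.
move=> Fl; elim: s => [|i s IH].
  rewrite big_nil; under eq_fun do rewrite big_nil; exact: cvg_cst.
rewrite big_cons; under eq_fun do rewrite big_cons; exact: cvgD.
Qed.

Section riccati_calculus.
Context {R : realType} {n : nat}.
Local Notation V := 'rV[R]_n.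
Local Notation mu := (lebesgue_rV R n).
Variables (Omega : set V) (Omega_open : open Omega) (sigma : schwartz_distr Omega).
Implicit Types (f g phi h b : V -> R) (K : set V) (Gamma : V -> V).

Let mOmega : measurable Omega := open_measurable_rV Omega_open.

Lemma continuous_field_lincomb (a c : R) Gamma1 Gamma2 :
  continuous_field Gamma1 -> continuous_field Gamma2 ->
  continuous_field (a *: Gamma1 + c *: Gamma2).
Proof.
move=> c1 c2 i.
rewrite (_ : (fun x => _) =
    fun x => a * Gamma1 x ord0 i + c * Gamma2 x ord0 i); last first.
  by apply/funext => x; rewrite !mxE.
apply: (@CkD _ _ 0); apply: continuous_mulr; do ?exact: cst_continuous.
  exact: c1.
exact: c2.
Qed.

Lemma riccati_lincomb Gamma (a : R) f g : L2loc_vec Omega Gamma ->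
  test_function Omega f -> test_function Omega g ->
  riccati sigma Gamma (fun x => a * f x + g x) =
    a * riccati sigma Gamma f + riccati sigma Gamma g.
Proof.
move=> G2 tf tg; have [sf _ _] := tf; have [sg _ _] := tg.
rewrite /riccati schwartz_linear//.
have -> : \int[mu]_(x in Omega) riccati_integrand Gamma (fun x => a * f x + g x) x =
    \int[mu]_(x in Omega) (a * riccati_integrand Gamma f x + riccati_integrand Gamma g x).
  apply: eq_Rintegral => x _; rewrite /riccati_integrand.
  have -> : grad (fun x => a * f x + g x) x = a *: grad f x + 1 *: grad g x.
    apply/rowP => i; rewrite !mxE mul1r (partialD _ _ _ sg).
      by rewrite partialZ.
    exact: (smoothM (smooth_cst a) sf).
  have -> u v w : dot u (a *: v + 1 *: w) = a * dot u v + dot u w :> R.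
    rewrite /dot mulr_sumr -big_split; apply: eq_bigr => i _ /=.
    by rewrite !mxE; ring.
  by ring.
rewrite RintegralD//; last 2 first.
- by apply: integrableZ_EFin => //; exact: integrable_riccati.
- exact: integrable_riccati.
rewrite RintegralZl; last exact: integrable_riccati.
  by rewrite addrACA -mulrDr.
exact: mOmega.
Qed.

(** A weighted family of constraints is the constraint of a single test function. This is how the
    weights of [convex_alternative] are absorbed, so that [riccati_test_field] applies. *)
Lemma riccati_sum Gamma (I : Type) (s : seq I) (l : I -> R) (phi : I -> V -> R) :
  L2loc_vec Omega Gamma -> (forall i, test_function Omega (phi i)) ->
  \sum_(i <- s) l i * riccati sigma Gamma (phi i) =
    riccati sigma Gamma (fun x => \sum_(i <- s) l i * phi i x).
Proof.
move=> G2 tphi; elim: s => [|i s IH].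
  have t0 : test_function Omega (cst 0 : V -> R).
    have := @test_function_sum _ _ Omega I [::] phi tphi.
    by rewrite (_ : (fun _ => _) = cst 0)//; apply/funext => x; rewrite big_nil.
  (* Coefficient -1 on the zero function gives a value of the form - a + a, hence 0. *)
  have := riccati_lincomb (-1) G2 t0 t0.
  rewrite (_ : (fun x => -1 * cst 0 x + cst 0 x) = cst 0 :> (V -> R)); last first.
    by apply/funext => x /=; rewrite mulr0 addr0.
  rewrite mulN1r addNr big_nil => r0.
  have -> : (fun x : V => \sum_(i <- [::]) l i * phi i x) = cst 0.
    by apply/funext => x; rewrite big_nil.
  exact: esym r0.
rewrite big_cons IH -riccati_lincomb//.
  by congr riccati; apply/funext => x; rewrite big_cons.
by apply: test_function_sum => j; exact: test_functionZ.
Qed.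

Lemma riccati_convex Gamma1 Gamma2 (t : R) phi :
  continuous_field Gamma1 -> continuous_field Gamma2 ->
  test_function Omega phi -> (forall x, 0 <= phi x) -> 0 <= t <= 1 ->
  riccati sigma ((1 - t) *: Gamma1 + t *: Gamma2) phi <=
    (1 - t) * riccati sigma Gamma1 phi + t * riccati sigma Gamma2 phi.
Proof.
move=> c1 c2 tphi phi0 /andP[t0 t1].
have L c := @L2loc_vec_continuous _ _ _ Omega_open c.
have i1 := integrable_riccati Omega_open (L _ c1) tphi.
have i2 := integrable_riccati Omega_open (L _ c2) tphi.
have i12 := integrable_riccati Omega_open
  (L _ (@continuous_field_lincomb (1 - t) t _ _ c1 c2)) tphi.
have : \int[mu]_(x in Omega) riccati_integrand ((1 - t) *: Gamma1 + t *: Gamma2) phi x <=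
    \int[mu]_(x in Omega) ((1 - t) * riccati_integrand Gamma1 phi x +
      t * riccati_integrand Gamma2 phi x).
  apply: le_Rintegral => //.
    by apply: integrableD_EFin => //; exact: integrableZ_EFin.
  move=> x _; rewrite /riccati_integrand.
  have -> : ((1 - t) *: Gamma1 + t *: Gamma2) x =
    (1 - t) *: Gamma1 x + t *: Gamma2 x by [].
  rewrite dot_lincomb.
  have -> u v w : dot ((1 - t) *: u + t *: v) w = (1 - t) * dot u w + t * dot v w :> R.
    rewrite /dot !mulr_sumr -big_split; apply: eq_bigr => i _ /=.
    by rewrite !mxE; ring.
  have := dot_ge0 (1 *: Gamma1 x + (-1) *: Gamma2 x); rewrite dot_lincomb.
  move: (dot (Gamma1 x) (Gamma1 x)) (dot (Gamma1 x) (Gamma2 x))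
    (dot (Gamma2 x) (Gamma2 x)) => A B C ABC.
  rewrite -subr_ge0 (_ : _ - _ = t * (1 - t) * (A - 2 * B + C) * phi x); last by ring.
  rewrite mulr_ge0// mulr_ge0//; last by lra.
  by rewrite mulr_ge0// subr_ge0.
rewrite [leRHS]RintegralD//; try exact: integrableZ_EFin.
rewrite !RintegralZl// /riccati => h.
apply: (le_trans (lerD (lexx (sigma phi)) h)).
by rewrite le_eqVlt; apply/orP; left; apply/eqP; ring.
Qed.

(** With [b ^+ 2] as test function, the cross term 2 b Gamma . grad b is absorbed by half of
    |Gamma|^2 b^2 and by 2 |grad b|^2, because |2 grad b + b Gamma|^2 >= 0. The bound depends on
    [sigma] and [b] but not on the field, which makes the constraint sets bounded in L^2_loc. *)
Lemma riccati_sqr_bound b : test_function Omega b ->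
  exists2 M : R, 0 < M & forall Gamma, continuous_field Gamma ->
    riccati sigma Gamma (fun x => b x ^+ 2) <= 1 ->
    \int[mu]_(x in Omega) (dot (Gamma x) (Gamma x) * b x ^+ 2) <= M.
Proof.
move=> tb; have [sb _ _] := tb; have tb2 := test_function_sqr tb.
pose A := 2 * (1 - sigma (fun x => b x ^+ 2) +
  2 * \int[mu]_(x in Omega) dot (grad b x) (grad b x)).
exists (1 + `|A|); first by rewrite ltr_pwDl.
move=> Gamma cG; have G2 := L2loc_vec_continuous Omega_open cG.
have ig := integrable_grad_sqr Omega_open tb.
have id := integrable_dot_test Omega_open G2 tb2.
have ir := integrable_riccati Omega_open G2 tb2.
have : \int[mu]_(x in Omega) (2^-1 * (dot (Gamma x) (Gamma x) * b x ^+ 2)) <=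
    \int[mu]_(x in Omega) (riccati_integrand Gamma (fun x => b x ^+ 2) x +
      2 * dot (grad b x) (grad b x)).
  apply: le_Rintegral => //.
  - exact: integrableZ_EFin.
  - by apply: integrableD_EFin => //; exact: integrableZ_EFin.
  move=> x _; rewrite /riccati_integrand.
  have -> : grad (fun x => b x ^+ 2) x = (2 * b x) *: grad b x.
    by apply/rowP => i; rewrite !mxE (partialM i x sb sb); ring.
  rewrite dotC dotZl; have := dot_ge0 (2 *: grad b x + b x *: Gamma x).
  rewrite dot_lincomb.
  by move: (dot _ _) (dot _ _) (dot _ _) => p q r; nra.
rewrite RintegralZl// RintegralD//; last exact: integrableZ_EFin.
rewrite RintegralZl// /riccati => h1 h2.
apply: (@le_trans _ _ A); last by rewrite (le_trans (ler_norm A))// lerDr.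
move: h1 h2; rewrite /A; move: (\int[mu]_(_ in _) _) (\int[mu]_(_ in _) _)
  (\int[mu]_(_ in _) _) (sigma _) => p q r s; lra.
Qed.

Lemma Rintegral_subset K f : compact K -> K `<=` Omega -> (forall x, 0 <= f x) ->
  mu.-integrable Omega (EFin \o f) ->
  \int[mu]_(x in K) f x <= \int[mu]_(x in Omega) f x.
Proof.
move=> cK KO f0 if_; have mK := compact_measurable_rV cK.
have iK : mu.-integrable K (EFin \o f) by exact: integrableS if_.
apply: fine_le; [exact: integrable_fin_num iK|exact: integrable_fin_num if_|].
apply: ge0_subset_integral => //; first by have [] := integrableP _ _ _ if_.
by move=> x _; rewrite lee_fin.
Qed.

Lemma Rintegral_support K f : K `<=` Omega -> (forall x, ~ K x -> f x = 0) ->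
  \int[mu]_(x in Omega) f x = \int[mu]_(x in K) f x.
Proof.
move=> KO f0; rewrite Rintegral_mkcond [RHS]Rintegral_mkcond.
apply: eq_Rintegral => x _; rewrite !patchE.
have [xK|xK] := boolP (x \in K).
  by rewrite mem_set//; apply: KO; rewrite inE in xK.
rewrite f0 ?if_same// => Kx.
by move/negP : xK; apply; rewrite inE.
Qed.

Lemma riccati_cvg (y : nat -> V -> V) Gamma (H : 'I_n -> V -> R) phi :
  (forall k, continuous_field (y k)) -> L2loc_vec Omega Gamma ->
  test_function Omega phi ->
  (forall i, mu.-integrable (supp phi) (EFin \o H i)) ->
  (forall i, {ae mu, forall x, Omega x ->
     y k x ord0 i @[k --> \oo] --> Gamma x ord0 i}) ->
  (forall i, {ae mu, forall x, Omega x -> forall k, y k x ord0 i ^+ 2 <= H i x}) ->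
  riccati sigma (y k) phi @[k --> \oo] --> riccati sigma Gamma phi.
Proof.
move=> cy G2 tphi iH yG yH; have [sphi cphi phiO] := tphi.
have mphi := compact_measurable_rV cphi.
have ric0 G x : ~ supp phi x -> riccati_integrand G phi x = 0.
  move=> nx; rewrite /riccati_integrand (supp_eq0 nx) mulr0 addr0 /dot big1// => i _.
  by rewrite mxE (partial_supp i nx) mulr0.
have L2 k := L2loc_vec_continuous Omega_open (cy k).
have iK G : L2loc_vec Omega G ->
    mu.-integrable (supp phi) (EFin \o riccati_integrand G phi).
  by move=> G2'; apply: integrableS (integrable_riccati Omega_open G2' tphi).
have [C0 C0ge phiC] := continuous_bounded cphi (smooth_continuous sphi).
have Cex i : exists C : R, 0 <= C /\ forall x, supp phi x -> `|partial i phi x| <= C.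
  have [C ? ?] := continuous_bounded cphi (smooth_continuous_partial (i := i) sphi).
  by exists C.
pose C i := projT1 (cid (Cex i)).
have [Cge CP] : (forall i, 0 <= C i) /\
    (forall i x, supp phi x -> `|partial i phi x| <= C i).
  by split=> i; rewrite /C; case: cid => ? [].
(* From a^2 <= H the linear term is bounded by |a| <= 1 + H and the quadratic one by H. *)
pose D x := \sum_(i < n) (C i * (1 + H i x) + C0 * H i x).
have iD : mu.-integrable (supp phi) (EFin \o D).
  apply: integrable_sum_EFin => // i; apply: integrableD_EFin => //.
    apply: integrableZ_EFin => //; apply: integrableD_EFin => //.
    exact: integrable_cst_compact.
  exact: integrableZ_EFin.
have := @dominated_convergence _ _ _ mu (supp phi) mphi
  (fun k => EFin \o riccati_integrand (y k) phi)
  (EFin \o riccati_integrand Gamma phi) (EFin \o D).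
case.
- by move=> k; have [] := integrableP _ _ _ (iK _ (L2 k)).
- by have [] := integrableP _ _ _ (iK _ G2).
- have : {ae mu, forall x i, Omega x ->
      y k x ord0 i @[k --> \oo] --> Gamma x ord0 i} by exact: filter_forall.
  apply: filterS => x yGx /phiO Ox.
  apply/fine_cvgP; split; first exact: nearW.
  apply: (@cvgD _ _ _ _ _ (fun k => dot (y k x) (grad phi x))
    (fun k => dot (y k x) (y k x) * phi x)).
    apply: cvg_seq_sum => i.
    by apply: cvgM; [exact: yGx|exact: cvg_cst].
  apply: cvgM; last exact: cvg_cst.
  by apply: cvg_seq_sum => i; apply: cvgM; exact: yGx.
- exact: iD.
- have : {ae mu, forall x i, Omega x -> forall k, y k x ord0 i ^+ 2 <= H i x}.
    exact: filter_forall.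
  apply: filterS => x yHx k phix /=.
  have Ox := phiO _ phix.
  rewrite lee_fin /riccati_integrand /dot mulr_suml -big_split/=.
  apply: (le_trans (ler_norm_sum _ _ _)); apply: ler_sum => i _.
  apply: (le_trans (ler_normD _ _)); rewrite mxE !normrM.
  have yx := yHx i Ox k; have := CP i x phix; have := phiC x phix.
  have H0 : 0 <= H i x by apply: le_trans yx; exact: sqr_ge0.
  have ya : `|y k x ord0 i| <= 1 + H i x.
    move: yx; rewrite -real_normK ?num_real//.
    by move: (`|y k x ord0 i|) => a; nra.
  have ya2 : `|y k x ord0 i| * `|y k x ord0 i| <= H i x.
    by rewrite -expr2 real_normK ?num_real.
  move=> h1 h2; apply: lerD.
    by rewrite mulrC ler_pM.
  by rewrite mulrC ler_pM// mulr_ge0.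
move=> _ _ cvgI.
apply: cvgD; first exact: cvg_cst.
rewrite (Rintegral_support phiO (ric0 Gamma)).
under eq_fun do rewrite (Rintegral_support phiO (ric0 (y _))).
apply: fine_cvg; rewrite fineK; first exact: cvgI.
by apply: integrable_fin_num => //; exact: iK.
Qed.

End riccati_calculus.

(** * Existence of a field satisfying all constraints *)

Section riccati_existence.
Context {R : realType} {n : nat}.
Local Notation V := 'rV[R]_n.
Local Notation mu := (lebesgue_rV R n).
Variables (Omega : set V) (Omega_open : open Omega) (sigma : schwartz_distr Omega).
Implicit Types (f g phi h b : V -> R) (K : set V) (Gamma : V -> V).

Let mOmega : measurable Omega := open_measurable_rV Omega_open.

Hypothesis form_bound : forall h, test_function Omega h ->
  sigma (fun x => h x ^+ 2) <= \int[mu]_(x in Omega) dot (grad h x) (grad h x).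

Let nonneg_test phi := test_function Omega phi /\ forall x, 0 <= phi x.

Lemma riccati_finite (s : seq (V -> R)) (e : R) :
  (forall phi, phi \in s -> nonneg_test phi) -> 0 < e ->
  exists2 Gamma, continuous_field Gamma &
    forall phi, phi \in s -> riccati sigma Gamma phi <= e.
Proof.
move=> ts e0.
pose phi (i : 'I_(size s)) := nth (cst 0) s i.
have tphi i : nonneg_test (phi i) by apply: ts; exact: mem_nth.
pose E : set (V -> V) := [set Gamma | continuous_field Gamma].
have [] := @convex_alternative R (size s) (V -> V : lmodType R) E
  (fun i Gamma => riccati sigma Gamma (phi i)) _ _ _ _ e e0.
- exists (cst 0) => i.
  rewrite (_ : (fun x => _) = cst 0); first exact: cst_continuous.
  by apply/funext => x; rewrite mxE.
- by move=> x y t cx cy _; exact: continuous_field_lincomb.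
- move=> i x y t cx cy t01; have [tp p0] := tphi i.
  exact: riccati_convex.
- move=> l d l0 d0.
  have tl i : test_function Omega (phi i) by have [] := tphi i.
  have tsum : test_function Omega (fun x => \sum_(i < size s) l i * phi i x).
    by apply: test_function_sum => i; exact: test_functionZ.
  have [x|Gamma cG Gd] := riccati_test_field Omega_open form_bound tsum _ d0.
    by apply: sumr_ge0 => i _; rewrite mulr_ge0//; have [] := tphi i.
  exists Gamma => //.
  by rewrite (riccati_sum Omega_open)//; exact: L2loc_vec_continuous.
move=> Gamma cG Gs; exists Gamma => // f fs.
have fsi : (index f s < size s)%N by rewrite index_mem.
by have := Gs (Ordinal fsi); rewrite /phi /= nth_index.
Qed.

Lemma cutoffs_exist : exists b : nat -> V -> R, forall j,
  nonneg_test (b j) /\ forall x, exhaust Omega j x -> b j x = 1.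
Proof.
have bex j : exists b, nonneg_test b /\ forall x, exhaust Omega j x -> b x = 1.
  have [b [tb b0 b1]] := smooth_urysohn Omega_open
    (@exhaust_compact _ _ Omega j) (@exhaust_sub _ _ Omega j).
  by exists b.
by exists (fun j => projT1 (cid (bex j))) => j; case: cid.
Qed.

(** Estimates on a compact set hold only once the exhaustion has reached it; the finitely many
    earlier terms go into the constant. *)
Lemma geometric_majorant (I : nat -> R) (c : R) (j : nat) :
  (forall k, 0 <= I k) -> (forall k, (j < k)%N -> I k <= c * 16^-1 ^+ k) ->
  exists C : R, forall k, I k <= C * 16^-1 ^+ k.
Proof.
move=> I0 Ic; exists (`|c| + \sum_(i < j.+1) I i * 16 ^+ i) => k.
have q0 i : 0 <= 16^-1 ^+ i :> R by rewrite exprn_ge0// invr_ge0.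
have S0 (P : pred 'I_j.+1) : 0 <= \sum_(i < j.+1 | P i) I i * 16 ^+ i.
  by apply: sumr_ge0 => i _; rewrite mulr_ge0// exprn_ge0.
have [jk|kj] := ltnP j k.
  apply: (le_trans (Ic k jk)); rewrite ler_wpM2r//.
  by rewrite (le_trans (ler_norm c))// lerDl.
rewrite (bigD1 (Ordinal (kj : (k < j.+1)%N)))//=.
rewrite addrCA mulrDl -mulrA exprVn divff ?expf_neq0// mulr1.
by rewrite lerDl -exprVn mulr_ge0// addr_ge0.
Qed.

(* [D i] collects the finitely many constraints of index [i]; the quadratic forms
   [Q k] exhaust L^2_loc and are bounded on the constraint sets. *)
Lemma riccati_exists : exists Gamma, L2loc_vec Omega Gamma /\
  forall phi, nonneg_test phi -> riccati sigma Gamma phi <= 0.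
Proof.
have [b bP] := cutoffs_exist.
have tb j : test_function Omega (b j) by have [[]] := bP j.
have tb2 j := test_function_sqr (tb j).
have Mex j : exists M : R, 0 < M /\ forall Gamma, continuous_field Gamma ->
    riccati sigma Gamma (fun x => b j x ^+ 2) <= 1 ->
    \int[mu]_(x in Omega) (dot (Gamma x) (Gamma x) * b j x ^+ 2) <= M.
  by have [M M0 MP] := riccati_sqr_bound Omega_open sigma (tb j); exists M.
have {Mex} [M MP] := choice Mex.
have M0 j : 0 < M j by have [] := MP j.
(* Dividing by the bound [M j] makes the [j]-th term of [Q] at most 2^-j on the constraint sets, so
   that [Q] is bounded by 2 at every level. *)
pose c j : R := 2^-1 ^+ j / M j.
have c0 j : 0 < c j by rewrite divr_gt0// exprn_gt0.
pose W k x := \sum_(j < k) c j * b j x ^+ 2.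
have tW k : test_function Omega (W k).
  by apply: test_function_sum => j; exact: test_functionZ.
pose Q k Gamma := \int[mu]_(x in Omega) (dot (Gamma x) (Gamma x) * W k x).
have L2 Gamma : continuous_field Gamma -> L2loc_vec Omega Gamma.
  exact: L2loc_vec_continuous.
have iQ k Gamma : continuous_field Gamma ->
    mu.-integrable Omega (EFin \o (fun x => dot (Gamma x) (Gamma x) * W k x)).
  by move=> cG; apply: integrable_dot_test => //; exact: L2.
have W0 k x : 0 <= W k x.
  by apply: sumr_ge0 => j _; rewrite mulr_ge0 ?sqr_ge0// ltW.
have Wge k j x : (j < k)%N -> exhaust Omega j x -> c j <= W k x.
  move=> jk jx; rewrite /W (bigD1 (Ordinal jk))//= (bP j).2// expr1n mulr1.
  by rewrite lerDl; apply: sumr_ge0 => i _; rewrite mulr_ge0 ?sqr_ge0// ltW.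
have WM k l x : (k <= l)%N -> W k x <= W l x.
  move=> kl; rewrite /W (big_ord_widen l (fun j => c j * b j x ^+ 2) kl).
  rewrite [leRHS](bigID (fun i : 'I_l => (i < k)%N))/= lerDl.
  by apply: sumr_ge0 => i _; rewrite mulr_ge0 ?sqr_ge0// ltW.
pose I := (seq (V -> R) * nat)%type.
pose leI (i j : I) := {subset i.1 <= j.1} /\ (i.2 <= j.2)%N.
pose join (i j : I) : I := (i.1 ++ j.1, maxn i.2 j.2).
(* The level [i.2] sets the tolerance, the number of bounding constraints and the truncation of [Q].
   Admissibility of [phi] is a premise inside the constraint, so every list is a legitimate
   index. *)
pose D (i : I) : set (V -> V) := [set Gamma |
  [/\ continuous_field Gamma,
      forall phi, phi \in i.1 -> nonneg_test phi ->
        riccati sigma Gamma phi <= i.2.+1%:R^-1 &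
      forall j, (j < i.2)%N -> riccati sigma Gamma (fun x => b j x ^+ 2) <= 1]].
have Qb i Gamma : D i Gamma -> Q i.2 Gamma <= 2.
  move=> [cG _ Gb]; apply: le_trans (sum_half_le i.2).
  rewrite /Q; have -> : \int[mu]_(x in Omega) (dot (Gamma x) (Gamma x) * W i.2 x) =
      \int[mu]_(x in Omega) (\sum_(j < i.2)
        c j * (dot (Gamma x) (Gamma x) * b j x ^+ 2)).
    apply: eq_Rintegral => x _; rewrite /W mulr_sumr; apply: eq_bigr => j _.
    by rewrite mulrCA.
  have ib j : mu.-integrable Omega
      (EFin \o (fun x => dot (Gamma x) (Gamma x) * b j x ^+ 2)).
    by apply: (integrable_dot_test Omega_open (L2 _ cG)); exact: tb2.
  rewrite Rintegral_sum//; last by move=> j; exact: integrableZ_EFin.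
  apply: ler_sum => j _; rewrite RintegralZl//.
  rewrite /c -mulrA ler_piMr ?exprn_ge0 ?invr_ge0// ler_pdivrMl// mulr1.
  by have [_] := MP j; apply => //; exact: Gb.
have Dne i : exists2 Gamma, D i Gamma & Q i.2 Gamma <= 2.
  (* Functions that are not admissible are filtered out. One tolerance serves both kinds of
     constraints, since [i.2.+1%:R^-1] is at most 1. *)
  pose s := [seq phi <- i.1 | `[< nonneg_test phi >]] ++
            [seq (fun x => b j x ^+ 2) | j <- iota 0 i.2].
  have e0 : 0 < i.2.+1%:R^-1 :> R by rewrite invr_gt0.
  have [|Gamma cG Gs] := @riccati_finite s _ _ e0.
    move=> phi; rewrite mem_cat mem_filter => /orP[/andP[/asboolP]//|].
    by move=> /mapP[j _ ->]; split; [exact: tb2|move=> x; exact: sqr_ge0].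
  suff DG : D i Gamma by exists Gamma => //; exact: Qb.
  split => // [phi phii tphi|j ji].
    by apply: Gs; rewrite mem_cat mem_filter phii andbT; apply/orP; left; apply/asboolP.
  apply: (@le_trans _ _ i.2.+1%:R^-1); last by rewrite invf_le1// ler1n.
  apply: Gs; rewrite mem_cat; apply/orP; right; apply/mapP; exists j => //.
  by rewrite mem_iota.
(* Prescribing the indices [([::], k)] forces the level of [a k] to be at least [k], so the
   tolerances tend to 0 and the forms exhaust [Omega]. *)
have [||||||||||a [x [ea Dx xx xy]]] := @directed_minimizers R (V -> V : lmodType R) I
    leI join D (fun i => Q i.2) _ _ _ _ _ _ _ _ 2 Dne
    (fun k => 16^-1 ^+ k) (fun k => ([::], k)).
- move=> i j k [ij1 ij2] [jk1 jk2]; split; last exact: leq_trans jk2.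
  by move=> phi /ij1/jk1.
- move=> i j; split; last exact: leq_maxl.
  by move=> phi phii; rewrite mem_cat phii.
- move=> i j; split; last exact: leq_maxr.
  by move=> phi phij; rewrite mem_cat phij orbT.
- move=> i j [ij1 ij2] Gamma [cG G1 G2]; split => // [phi phii tphi|k ki].
    apply: (le_trans (G1 phi (ij1 _ phii) tphi)).
    by rewrite lef_pV2 ?posrE ?ltr0n// ler_nat.
  by apply: G2; exact: leq_trans ij2.
- move=> i j Gamma [_ ij2] [cG _ _]; apply: le_Rintegral => //; try exact: iQ.
  by move=> y _; rewrite ler_wpM2l ?dot_ge0// WM.
- by move=> i Gamma; apply: Rintegral_ge0 => y _; rewrite mulr_ge0// dot_ge0.
- move=> i G1 G2 [c1 r1 s1] [c2 r2 s2].
  have half01 : 0 <= (2^-1 : R) <= 1 by rewrite invr_ge0 ler0n invf_le1 ?ler1n.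
  have -> : 2^-1 *: (G1 + G2) = (1 - 2^-1) *: G1 + 2^-1 *: G2 :> (V -> V).
    by rewrite scalerDr; congr (_ *: _ + _); field.
  have mid (u v w : R) : u <= w -> v <= w -> (1 - 2^-1) * u + 2^-1 * v <= w.
    by move=> ? ?; lra.
  split; first exact: continuous_field_lincomb.
    move=> phi phii tphi; have [tp p0] := tphi.
    apply: (le_trans (riccati_convex Omega_open sigma c1 c2 tp p0 half01)).
    by apply: mid; [exact: r1|exact: r2].
  move=> j ji.
  apply: (le_trans (riccati_convex Omega_open sigma c1 c2 (tb2 j)
    (fun x => sqr_ge0 (b j x)) half01)).
  by apply: mid; [exact: s1|exact: s2].
- move=> i G1 G2 [c1 _ _] [c2 _ _].
  have cm : continuous_field (2^-1 *: (G1 + G2)).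
    by rewrite scalerDr; exact: continuous_field_lincomb.
  have cB : continuous_field (G1 - G2).
    by rewrite -[G1]scale1r -scaleN1r; exact: continuous_field_lincomb.
  have : \int[mu]_(x in Omega) (2 * (dot (G1 x) (G1 x) * W i.2 x) +
        2 * (dot (G2 x) (G2 x) * W i.2 x)) =
      \int[mu]_(x in Omega) (dot ((G1 - G2) x) ((G1 - G2) x) * W i.2 x +
        4 * (dot ((2^-1 *: (G1 + G2)) x) ((2^-1 *: (G1 + G2)) x) * W i.2 x)).
    apply: eq_Rintegral => y _.
    have -> : (G1 - G2) y = 1 *: G1 y + (-1) *: G2 y by rewrite scale1r scaleN1r.
    have -> : (2^-1 *: (G1 + G2)) y = 2^-1 *: G1 y + 2^-1 *: G2 y.
      by rewrite -scalerDr.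
    by rewrite !dot_lincomb; field.
  have i1 := iQ i.2 _ c1; have i2 := iQ i.2 _ c2.
  have im := iQ i.2 _ cm; have iB := iQ i.2 _ cB.
  rewrite [LHS]RintegralD//; try exact: integrableZ_EFin.
  rewrite [RHS]RintegralD//; try exact: integrableZ_EFin.
  by rewrite !RintegralZl// /Q => ->; rewrite addrK.
- by move=> k; rewrite exprn_gt0// invr_gt0.
- by move=> k; rewrite exprS ler_piMl ?exprn_ge0 ?invr_ge0//; lra.
have xc k : continuous_field (x k) by have [] := Dx k.
have ak k : (k <= (a k).2)%N by have [] := ea k.
(* On a compact set inside [exhaust Omega j] the weight is at least [c j] as soon as the level
   exceeds [j], which holds for [k > j]; there [Q] controls the square of each coordinate. *)
have Qlow (z : nat -> V -> V) i : (forall k, continuous_field (z k)) ->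
    (forall k, Q (a k).2 (z k) <= 16^-1 ^+ k) ->
    forall K, compact K -> K `<=` Omega -> exists C : R, forall k,
      \int[mu]_(y in K) (z k y ord0 i ^+ 2) <= C * 16^-1 ^+ k.
  move=> cz Qz K cK KO; have mK := compact_measurable_rV cK.
  have [j jP] := exhaust_ge Omega_open cK KO.
  apply: (@geometric_majorant _ (c j)^-1 j) => k.
    by apply: Rintegral_ge0 => y _; exact: sqr_ge0.
  move=> jk; rewrite -ler_pdivrMl ?invr_gt0// invrK.
  apply: le_trans (Qz k); rewrite -RintegralZl//; last first.
    by apply: integrable_sqr_compact => //; exact: cz.
  have iz := iQ (a k).2 _ (cz k).
  have zW y : 0 <= dot (z k y) (z k y) * W (a k).2 y by rewrite mulr_ge0// dot_ge0.
  apply: le_trans (Rintegral_subset Omega_open cK KO zW iz).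
  apply: le_Rintegral => //.
  - by apply: integrableZ_EFin => //; apply: integrable_sqr_compact => //; exact: cz.
  - exact: integrableS iz.
  move=> y Ky; rewrite mulrC ler_pM ?sqr_ge0 ?coord_sqr_le_dot//; first exact: ltW.
  apply: Wge; first exact: leq_trans (ak k).
  exact: (jP j (leqnn j)).
have cB (G1 G2 : V -> V) : continuous_field G1 -> continuous_field G2 ->
    continuous_field (G1 - G2).
  move=> c1 c2; rewrite -[G1]scale1r -scaleN1r; exact: continuous_field_lincomb.
have lex i : exists lH : (V -> R) * (V -> R), [/\ measurable_fun setT lH.1,
    forall K, compact K -> K `<=` Omega -> mu.-integrable K (EFin \o lH.2),
    {ae mu, forall y, Omega y -> x k y ord0 i @[k --> \oo] --> lH.1 y} &
    {ae mu, forall y, Omega y -> forall k, x k y ord0 i ^+ 2 <= lH.2 y}].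
  have [|l [H lHP]] := @fast_L2_limit R n Omega Omega_open (fun k y => x k y ord0 i)
    (fun k => xc k i); last by exists (l, H).
  move=> K cK KO.
  have [C CP] := Qlow (fun k => x k - x k.+1) i
    (fun k => cB _ _ (xc k) (xc k.+1)) xx K cK KO.
  exists C => k; have := CP k; congr (_ <= _); apply: eq_Rintegral => y _.
  by rewrite !mxE.
have [lH lHP] := choice lex.
pose Gamma y : V := \row_i (lH i).1 y.
have G2 : L2loc_vec Omega Gamma.
  move=> i; rewrite (_ : (fun y => _) = (lH i).1); last first.
    by apply/funext => y; rewrite mxE.
  have [ml iH cl bl] := lHP i.
  apply: L2locP => //; first exact: measurable_funTS.
  move=> K cK KO; exists (lH i).2; last exact: iH.
  apply: filterS2 cl bl => y cy by_ Ky.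
  have Oy := KO y Ky.
  have sq : x k y ord0 i ^+ 2 @[k --> \oo] --> (lH i).1 y ^+ 2.
    by apply: cvgM; exact: cy.
  apply: (ler_cvg_to sq (cvg_cst _)); apply: nearW => k; exact: by_.
exists Gamma; split => // phi tphi; have [tp p0] := tphi.
(* Joining [([:: phi], 0)] puts [phi] into the list and leaves the level of [a k] unchanged, so
   [y k] satisfies the constraint of [phi] with a tolerance at most 1 / (k + 1). *)
have [y yP] := xy ([:: phi], 0%N).
have yc k : continuous_field (y k) by have [[]] := yP k.
have Hex i : exists H' : V -> R, [/\
    forall K, compact K -> K `<=` Omega -> mu.-integrable K (EFin \o H'),
    {ae mu, forall z, Omega z -> y k z ord0 i @[k --> \oo] --> Gamma z ord0 i} &
    {ae mu, forall z, Omega z -> forall k, y k z ord0 i ^+ 2 <= H' z}].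
  have [ml iH cl bl] := lHP i.
  apply: (@fast_L2_null R n Omega Omega_open (fun k z => x k z ord0 i)
    (fun k z => y k z ord0 i) _ (lH i).2) => //.
  - by move=> k; exact: xc.
  - by move=> k; exact: yc.
  - by apply: filterS cl => z; rewrite mxE.
  move=> K cK KO.
  have [C CP] := Qlow (fun k => x k - y k) i (fun k => cB _ _ (xc k) (yc k))
    (fun k => (yP k).2) K cK KO.
  exists C => k; have := CP k; congr (_ <= _); apply: eq_Rintegral => z _.
  by rewrite !mxE.
have [H HP] := choice Hex.
have [_ cphi phiO] := tp.
have cv := @riccati_cvg R n Omega Omega_open sigma y Gamma H phi yc G2 tp
  (fun i => let: And3 h _ _ := HP i in h _ cphi phiO)
  (fun i => let: And3 _ h _ := HP i in h)
  (fun i => let: And3 _ _ h := HP i in h).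
apply: (ler_cvg_to cv (@cvg_harmonic R)); apply: nearW => k.
have [[_ r _] _] := yP k; apply: (le_trans (r phi _ tphi)).
  by rewrite mem_cat mem_seq1 eqxx orbT.
by rewrite /harmonic /= lef_pV2 ?posrE ?ltr0n// ler_nat ltnS maxn0.
Qed.

End riccati_existence.

Theorem theorem1p3 (R : realType) (n : nat) (n_ge1 : (1 <= n)%N)
    (Omega : set 'rV[R]_n) (Omega_open : open Omega)
    (sigma : schwartz_distr Omega) :
  (forall h : 'rV[R]_n -> R, test_function Omega h ->
     sigma (fun x => h x ^+ 2) <=
       \int[lebesgue_rV R n]_(x in Omega) dot (grad h x) (grad h x)) <->
  (exists Gamma : 'rV[R]_n -> 'rV[R]_n,
     L2loc_vec Omega Gamma /\
     distr_le Omega sigma (fun phi =>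
       distr_div Omega Gamma phi -
       distr_of_fun Omega (fun x => dot (Gamma x) (Gamma x)) phi)).
Proof.
split=> [form_bound|[Gamma [G2 le_div]] h th].
  have [Gamma [G2 GP]] := riccati_exists Omega_open form_bound.
  exists Gamma; split => // phi tphi phi0.
  by rewrite -subr_le0 -(riccatiE Omega_open sigma G2 tphi); exact: GP.
have th2 := test_function_sqr th.
apply: (form_bound_of_riccati Omega_open G2 th).
rewrite (riccatiE Omega_open sigma G2 th2) subr_le0.
by apply: le_div => // x; exact: sqr_ge0.
Qed.
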